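(* The randomized truly online paging algorithm RTO (described in the context) is very strongly competitive on every access graph: there exist absolute constants $b_1,b_2\ge 0$ such that for every integer $k\ge 1$ and every (undirected) access graph $G$, $$r_{\mathrm{RTO}}(G,k)\le b_1\, r^\infty_{\mathsf{obl}}(G,k)+b_2 .$$
   Context: Paging: there is a cache with $k$ page slots, initially empty, and a finite request sequence $\sigma$ of pages. If a requested page is not in the cache a fault occurs, the page is brought in, and if the cache is full the algorithm must evict a page; an online algorithm makes this choice knowing only the requests so far (and, if randomized, its own random bits). $A(k,\sigma)$ denotes the number of faults of $A$ on $\sigma$ (a random variable if $A$ is randomized) and $\mathrm{OPT}(k,\sigma)$ the minimum possible number of faults of any (offline) strategy. Access graph model: an access graph $G$ is an undirected graph whose vertices are the pages; $\mathrm{paths}(G)$ is the set of finite request sequences in which every two consecutive requests are equal or adjacent in $G$. The strict competitive ratio of algorithm $A$ is $r_A(G,k)=\inf\{r:\forall\sigma\in\mathrm{paths}(G),\ E[A(k,\sigma)]\le r\,\mathrm{OPT}(k,\sigma)\}$, and its asymptotic competitive ratio is $r^\infty_A(G,k)=\inf\{r:\exists C\ge0\ \forall\sigma\in\mathrm{paths}(G),\ E[A(k,\sigma)]\le r\,\mathrm{OPT}(k,\sigma)+C\}$. $r^\infty_{\mathsf{obl}}(G,k)$ is the infimum of $r^\infty_A(G,k)$ over all randomized online algorithms $A$ (oblivious adversary: the sequence is fixed independently of $A$'s coins). Phases: $\sigma$ is partitioned into consecutive phases; the first phase starts at the beginning, and each phase ends at the end of $\sigma$ or just before the request to the $(k+1)$-st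 distinct page requested in that phase; the next phase starts right after. During a phase a page is marked if it has been requested in the current phase. A page is stale if it was requested in the previous phase and has not yet been requested or evicted in the current phase; it is a hole if it was requested in the previous phase, has been evicted during the current phase, and has not yet been requested in the current phase. Algorithm RTO$(k)$: it never evicts a marked page and evicts only on a fault with a full cache. At the start of each phase let $P$ be the set of pages requested in the previous phase (empty in the first phase), let $G_P$ be the graph on $P$ with an edge $uv$ ($u\ne v$) whenever $u,v$ were requested consecutively in the previous phase, and let $G_0$ be a spanning tree of $G_P$; all graph notions below refer to $G_0$. Each phase is split into three consecutive subphases. Subphase I: let $C$ be the set of vertices of $G_0$ of degree $\neq2$; on a fault evict a uniformly random stale page in $C$; if there is none, proceed to Subphase II. Subphase II: let $C'$ be the set of holes at the beginning of Subphase II; for each $v\in C'$ keep a set $A_v$, initially $\{v\}$; $v$ is alive as long as $A_v$ consists only of holes and some stale vertex is adjacent to $A_v$. On a fault choose an alive $v\in C'$ minimizing $|A_v|$ among alive vertices, evict a stale vertex $w$ adjacent to $A_v$, and set $A_v\leftarrow A_v\cup\{w\}$; if no alive $v$ exists, proceed to Subphase III. Subphase III: on a fault evict a uniformly random unmarked page. RTO is truly online: it does not receive $G$, only the requests. *)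

(* Defs.v *)
From HB Require Import structures.
From mathcomp Require Import all_boot all_order all_algebra.
From mathcomp Require Import all_classical all_reals all_analysis.
Set Implicit Arguments.
Unset Strict Implicit.
Unset Printing Implicit Defensive.
Import Order.TTheory GRing.Theory Num.Theory.
Local Open Scope ring_scope.
Local Open Scope classical_set_scope.

(** * Paging *)

(* An eviction rule maps the earlier requests and the current request to the
   page to evict; it is consulted only on a fault with a full cache.  Every rule
   denotes a legal strategy: a rule naming a page that is not in the cache evicts
   the first page of the list [c] instead. *)
Definition rule (T : Type) := seq T -> T -> T.

Section Paging.
Variables (T : eqType) (k : nat).
Implicit Types (c h s : seq T) (x r : T).

(* Cache after request [r], where [x] is the page proposed for eviction. *)
Definition serve c x r : seq T :=
  if r \in c then c
  else if (size c < k)%N then r :: c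
  else r :: rem (if x \in c then x else head r c) c.

Fixpoint faults_from (ev : rule T) h c s : nat :=
  if s is r :: s' then
    ((r \notin c) + faults_from ev (rcons h r) (serve c (ev h r) r) s')%N
  else 0%N.

Definition faults (ev : rule T) s : nat := faults_from ev [::] [::] s.

(* Prefixes of a fixed sequence identify the times, so for a fixed [s] the rules
   cover all offline strategies. *)
Lemma opt_ex s : exists n, `[< exists ev : rule T, faults ev s = n >].
Proof. by exists (faults (fun _ r => r) s); apply/asboolP; exists (fun _ r => r). Qed.

Definition opt s : nat := ex_minn (opt_ex s).

End Paging.

(** * Competitive ratios in the access graph model *)

Definition in_paths (T : eqType) (e : rel T) (s : seq T) : Prop :=
  sorted (fun u v => (u == v) || e u v) s.

Section Ratios.
Variables (R : realType) (T : eqType) (k : nat) (e : rel T).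
Local Open Scope ereal_scope.

(* [cost s] is the expected number of faults on [s].  Ratios range over
   nonnegative reals; otherwise the asymptotic ratio would be -oo whenever [opt]
   is bounded on the paths of the graph. *)
Definition strict_ratio (cost : seq T -> \bar R) : \bar R :=
  ereal_inf [set r%:E | r in [set r : R | (0 <= r)%R /\
    forall s, in_paths e s -> cost s <= r%:E * (opt k s)%:R%:E]].

Definition asymptotic_ratio (cost : seq T -> \bar R) : \bar R :=
  ereal_inf [set r%:E | r in [set r : R | (0 <= r)%R /\
    exists C : R, (0 <= C)%R /\
    forall s, in_paths e s -> cost s <= r%:E * (opt k s)%:R%:E + C%:E]].

(* A randomized online algorithm is a random eviction rule: [w] stands for its
   random bits.  [e] and [k] may be known to the algorithm. *)
Definition online_cost (cost : seq T -> \bar R) : Prop :=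
  exists (d : measure_display) (W : measurableType d) (P : probability W R)
         (ev : W -> rule T),
    (forall h r x, measurable [set w | ev w h r = x]) /\
    (forall s, cost s = 'E_P[fun w => (faults k (ev w) s)%:R]).

Definition r_obl : \bar R :=
  ereal_inf [set asymptotic_ratio cost | cost in online_cost].

End Ratios.

(** * Finitely supported probability distributions, as weighted lists *)

Section FinDist.
Variable R : numFieldType.

Definition dist (A : Type) := seq (R * A).

Definition dret A (a : A) : dist A := [:: (1, a)].

Definition dbind A B (d : dist A) (f : A -> dist B) : dist B :=
  flatten [seq [seq (p.1 * q.1, q.2) | q <- f p.2] | p <- d].

(* Meant for nonempty duplicate-free lists. *)
Definition uniform A (s : seq A) : dist A := [seq ((size s)%:R^-1, a) | a <- s].

Definition dexp A (d : dist A) (f : A -> R) : R := \sum_(p <- d) p.1 * f p.2.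

End FinDist.

(** * The algorithm RTO *)

Section RTO.
Variables (T : eqType).

(* In [SubII tab], [tab] lists the pairs (v, A_v) for v in C'. *)
Inductive subphase := SubI | SubII of seq (T * seq T) | SubIII.

Record state := State {
  hist : seq T;     (* all requests so far *)
  cache : seq T;
  prv : seq T;      (* requests of the previous phase, in order *)
  cur : seq T;      (* requests of the current phase, in order *)
  evd : seq T;      (* pages evicted in the current phase *)
  tree0 : rel T;    (* the spanning tree G_0 *)
  sub : subphase;
  nfaults : nat }.

Definition init_state : state :=
  State [::] [::] [::] [::] [::] (fun _ _ => false) SubI 0.

(* Vertex set P and edges of G_P, from the requests [p] of the previous phase. *)
Definition gverts (p : seq T) : seq T := undup p.
Definition gedge (p : seq T) : rel T := fun u v =>
  (u != v) && (((u, v) \in zip p (behead p)) || ((v, u) \in zip p (behead p))).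

Definition spanning_tree (p : seq T) (g : rel T) : Prop :=
  [/\ symmetric g,
      (forall u v, g u v -> gedge p u v),
      (forall u v, u \in gverts p -> v \in gverts p ->
         exists q, path g u q /\ last u q = v)
    & (forall c, uniq c -> cycle g c -> (size c <= 2)%N)].

Section State.
Variable st : state.

Definition marked x := x \in cur st.
Definition stale x :=
  [&& x \in prv st, x \notin cur st & x \notin evd st].
Definition hole x :=
  [&& x \in prv st, x \in evd st & x \notin cur st].

Definition deg x := count (tree0 st x) (gverts (prv st)).
Definition inC x := (x \in gverts (prv st)) && (deg x != 2).

Definition adjacent x (A : seq T) := has (fun a => tree0 st a x) A.
Definition alive (vA : T * seq T) :=
  all hole vA.2 && has (fun w => stale w && adjacent w vA.2) (gverts (prv st)).

(* [vw] = (v, w): the Subphase II step may evict w and add it to A_v. *)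
Definition legal_move (tab : seq (T * seq T)) (vw : T * T) : Prop :=
  (exists A, [/\ (vw.1, A) \in tab, alive (vw.1, A),
                 (forall vB, vB \in tab -> alive vB -> (size A <= size vB.2)%N)
               & adjacent vw.2 A])
  /\ stale vw.2.

Definition init_table : seq (T * seq T) :=
  [seq (v, [:: v]) | v <- gverts (prv st) & hole v].

End State.

Definition grow (vw : T * T) (tab : seq (T * seq T)) :=
  [seq if vA.1 == vw.1 then (vA.1, vw.2 :: vA.2) else vA | vA <- tab].

(* The choices that RTO leaves open: the spanning tree, which may depend on all
   earlier requests and must span G_P for the requests of the last phase, and the
   move in Subphase II, which may depend on the current state. *)
Record choices := Choices {
  pick_tree : seq T -> seq T -> rel T;
  pick_move : state -> seq (T * seq T) -> T * T }.

Definition legal_choices (ch : choices) : Prop :=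
  (forall h p, spanning_tree p (pick_tree ch h p)) /\
  (forall st tab, has (alive st) tab -> legal_move st tab (pick_move ch st tab)).

Variables (R : numFieldType) (k : nat) (ch : choices).

(* Law of the evicted page together with the subphase after the eviction. *)
Definition evict_III (st : state) : dist R (T * subphase) :=
  uniform R [seq (x, SubIII) | x <- cache st & ~~ marked st x].

Definition evict_II (st : state) (tab : seq (T * seq T)) : dist R (T * subphase) :=
  if has (alive st) tab then
    let vw := pick_move ch st tab in dret R (vw.2, SubII (grow vw tab))
  else evict_III st.

Definition evict_I (st : state) : dist R (T * subphase) :=
  let cand := [seq x <- gverts (prv st) | stale st x && inC st x] in
  if nilp cand then evict_II st (init_table st)
  else uniform R [seq (x, SubI) | x <- cand].

Definition evict (st : state) : dist R (T * subphase) :=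
  match sub st with
  | SubI => evict_I st
  | SubII tab => evict_II st tab
  | SubIII => evict_III st
  end.

(* A new phase starts just before the request [r] if [r] would be the (k+1)-st
   distinct page of the current one. *)
Definition start_phase (st : state) (r : T) : state :=
  let: State h c p q ed g sp n := st in
  if (r \notin q) && (k <= size (undup q))%N
  then State h c q [::] [::] (pick_tree ch h q) SubI n
  else st.

Definition mark (st : state) (r : T) : state :=
  let: State h c p q ed g sp n := st in State (rcons h r) c p (rcons q r) ed g sp n.

Definition load (st : state) (r : T) : state :=
  let: State h c p q ed g sp n := st in State h (r :: c) p q ed g sp n.+1.

Definition replace (st : state) (r : T) (o : T * subphase) : state :=
  let: State h c p q ed g sp n := st in
  State h (r :: rem o.1 c) p q (o.1 :: ed) g o.2 n.+1.

(* The requested page is marked before an eviction is decided; in particular it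
   is no longer a hole at that moment. *)
Definition step (st0 : state) (r : T) : dist R state :=
  let st := mark (start_phase st0 r) r in
  if r \in cache st then dret R st
  else if (size (cache st) < k)%N then dret R (load st r)
  else dbind (evict st) (fun o => dret R (replace st r o)).

Fixpoint run (st : state) (s : seq T) : dist R state :=
  if s is r :: s' then dbind (step st r) (fun st' => run st' s') else dret R st.

Definition rto_faults (s : seq T) : R :=
  dexp (run init_state s) (fun st => (nfaults st)%:R).

End RTO.

Definition r_RTO (R : realType) (T : eqType) (k : nat) (e : rel T) (ch : choices T)
    : \bar R :=
  strict_ratio k e (fun s => (rto_faults R k ch s)%:E).

(* Main.v *)
(** Let g be the number of new pages of a phase, i.e. of pages not requested in the
    previous phase.  OPT faults at least half the sum of the g's, so it suffices that
    RTO faults O(g (r + 1)) times in expectation per phase, where r is the ratio of an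
    arbitrary online algorithm.

    Lower bound on r.  Let K be connected in the access graph and let x_1, ..., x_m be
    further pages, each adjacent to K or to an earlier x_j, and also to K or to a later
    one, with |K| + m = k + g.  Then K together with a prefix and a suffix of the x_i is
    connected.  The adversary repeatedly requests K, what it has already requested of the
    x_i, and either the left or the right half of the remaining interval of the x_i.  The
    two options cover all k + g pages, so on average they cost any algorithm g/2, whereas
    the optimum pays g for the whole search.  Hence 2 r >= log (m/g), up to rounding.

    - Taking for the x_i the leaves of G_0, with one new page added to K, gives
      2 r >= log |C| - O(1).
    - At the start of Subphase III every neighbour of a stale page in G_0 is stale, marked,
      or in a set A_v containing a marked page.  Rooting G_0 at a vertex of C and ordering
      the stale pages by depth gives 2 r >= log (m/g) - O(1), m being their number.

    Upper bound.  In Subphases I and III each hole starts a chain of random evictions, and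
    the next hole of the chain is uniformly ranked in the order of the next requests: this
    gives g H_|C| expected faults in Subphase I and, as each of the last 2g unmarked pages
    faults at most once, g (H_m - H_g) + O(g) in Subphase III.  In Subphase II the i-th
    last of the sets A_v to die has at most g/i + 1 elements, which gives g H_|C| faults. *)

Require Import Defs.
From mathcomp Require Import all_boot all_order all_algebra.
From mathcomp Require Import all_classical all_reals all_analysis.
From mathcomp Require Import measurable_realfun zify ring lra.
Set Implicit Arguments.
Unset Strict Implicit.
Unset Printing Implicit Defensive.
Import Order.TTheory GRing.Theory Num.Theory.

(** * Caches, offline strategies and phases *)

Section SeqCounting.
Variable T : eqType.
Implicit Types (c q p s : seq T).

Lemma count_notin_sub c q : uniq c -> uniq q -> {subset c <= q} ->
  count [pred x | x \notin c] q = size q - size c.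
Proof.
move=> uc uq cq.
have <- : count (mem c) q = size c.
  rewrite -size_filter; apply/perm_size/uniq_perm => //; first exact: filter_uniq.
  by move=> x; rewrite mem_filter; apply/andb_idr/cq.
by rewrite -(count_predC (mem c) q) addKn; apply: eq_count.
Qed.

Lemma count_swap c q : uniq c -> uniq q -> size c <= size q ->
  count [pred x | x \notin q] c <= count [pred x | x \notin c] q.
Proof.
move=> uc uq cq.
have e : count (mem q) c = count (mem c) q.
  rewrite -!size_filter; apply/perm_size/uniq_perm; rewrite ?filter_uniq //.
  by move=> x; rewrite !mem_filter andbC.
have := count_predC (mem q) c; have := count_predC (mem c) q.
rewrite e => hq hc; move: cq; rewrite -hq -hc leq_add2l; exact: id.
Qed.

Lemma uniq_sub_count (X q : seq T) (a : pred T) : uniq X -> {subset X <= q} -> all a X ->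
  size X <= count a q.
Proof.
move=> uX Xq /allP aX; rewrite -size_filter; apply: uniq_leq_size => // x xX.
by rewrite mem_filter (Xq _ xX) (aX _ xX).
Qed.

Lemma size_undup_sub s t : {subset s <= t} -> size (undup s) <= size (undup t).
Proof.
by move=> st; apply: uniq_leq_size; rewrite ?undup_uniq // => x; rewrite !mem_undup; apply: st.
Qed.

End SeqCounting.

(** * Faults of a strategy, and offline strategies for blocks of requests *)

Section CacheDynamics.
Variables (T : eqType) (k : nat).
Implicit Types (ev : rule T) (c h s w V B : seq T) (r x : T).

Lemma mem_evicted c r x : 0 < size c -> (if x \in c then x else head r c) \in c.
Proof. by case: ifP => // _; case: c => //= y c _; rewrite mem_head. Qed.

Lemma serve_sub c x r : {subset serve k c x r <= r :: c}.
Proof.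
rewrite /serve => y; case: ifP => [_ yc|_]; first by rewrite inE yc orbT.
case: ifP => _ //; rewrite !inE => /orP[->//|/mem_rem ->]; exact: orbT.
Qed.

Lemma serve_uniq c x r : uniq c -> uniq (serve k c x r).
Proof.
move=> uc; rewrite /serve; case: ifP => // /negbT rc; case: ifP => _ /=; first by rewrite rc.
by rewrite rem_uniq // andbT; apply: contra rc; apply: mem_rem.
Qed.

Lemma size_serve c x r : 0 < k -> size c <= k -> size (serve k c x r) <= k.
Proof.
move=> k0 ck; rewrite /serve; case: ifP => // /negbT rc; case: ltnP => //= kc.
have c0 : 0 < size c by apply: leq_trans kc.
by rewrite size_rem ?mem_evicted // prednK.
Qed.

Fixpoint cache_from ev h c s : seq T :=
  if s is r :: s' then cache_from ev (rcons h r) (serve k c (ev h r) r) s' else c.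

Lemma faults_from_cat ev h c s t : faults_from k ev h c (s ++ t) =
  faults_from k ev h c s + faults_from k ev (h ++ s) (cache_from ev h c s) t.
Proof.
elim: s h c => [|r s IH] h c /=; first by rewrite cats0.
by rewrite IH cat_rcons addnA.
Qed.

Lemma cache_from_uniq ev h c s : uniq c -> uniq (cache_from ev h c s).
Proof. by elim: s h c => //= r s IH h c uc; apply: IH; apply: serve_uniq. Qed.

Lemma size_cache_from ev h c s : 0 < k -> size c <= k -> size (cache_from ev h c s) <= k.
Proof. by move=> k0; elim: s h c => //= r s IH h c ck; apply: IH; apply: size_serve. Qed.

Lemma cache_from_sub ev h c s : {subset cache_from ev h c s <= s ++ c}.
Proof.
elim: s h c => [|r s IH] h c x //= /IH.
by rewrite mem_cat inE mem_cat => /orP[->|/serve_sub]; rewrite ?orbT // inE => /orP[->|->]; rewrite ?orbT.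
Qed.

(** A page enters the cache only when it is requested, so each page of [X] faults at its first
    request in [s]. *)
Lemma size_le_faults ev h c s (X : seq T) : uniq X -> {subset X <= s} ->
  {in X, forall x, x \notin c} -> size X <= faults_from k ev h c s.
Proof.
elim: s h c X => [|r s IH] h c X uX Xs Xc /=.
  by case: X uX Xs Xc => // x X _ Xs _; have := Xs x (mem_head _ _).
case: (boolP (r \in c)) => rc.
  rewrite add0n; apply: IH => // x xX; have := Xs x xX; rewrite inE.
    by case: eqVneq => // xr; have := Xc x xX; rewrite xr rc.
  by rewrite /serve rc Xc.
have : size X <= 1 + size (rem r X).
  by case: (boolP (r \in X)) => rX; [rewrite size_rem // add1n leqSpred | rewrite rem_id].
move/leq_trans; apply; rewrite leq_add2l; apply: IH; rewrite ?rem_uniq //.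
  move=> x; rewrite mem_rem_uniq // inE => /andP[/negbTE xr /Xs]; by rewrite inE xr.
move=> x; rewrite mem_rem_uniq // inE => /andP[xr /Xc xc].
by apply: contra xc => /serve_sub; rewrite inE (negbTE xr).
Qed.

Lemma eq_faults_from ev ev' h c s :
  (forall h' r, size h <= size h' -> ev h' r = ev' h' r) ->
  faults_from k ev h c s = faults_from k ev' h c s.
Proof.
elim: s h c => //= r s IH h c E; rewrite E // IH // => h' r'.
by rewrite size_rcons => /ltnW; apply: E.
Qed.

(** Splices the choice [x] for the present request onto a rule for the later ones. Histories grow by
    one page per request, so their length tells the two apart. *)
Lemma offline_step h c r s x ev n :
  faults_from k ev (rcons h r) (serve k c x r) s = n ->
  exists ev', faults_from k ev' h c (r :: s) = (r \notin c) + n.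
Proof.
move=> <-; exists (fun h' r' => if size h' == size h then x else ev h' r').
rewrite /= eqxx; congr (_ + _); apply: eq_faults_from => h' r'.
by rewrite size_rcons; case: eqVneq => // ->; rewrite ltnn.
Qed.

(* Keeping as much of [B] as possible, every eviction brings the cache one page
   closer to [B]; this is charged to the g pages of V missing from a full cache. *)
Lemma offline_block V B g w t n :
  uniq V -> size V = k + g -> uniq B -> size B = k -> {subset B <= V} ->
  {subset w <= B} ->
  (forall h c, uniq c -> {subset c <= V} -> size c <= k ->
     exists ev, faults_from k ev h c t + size c <= n) ->
  forall h c, uniq c -> {subset c <= V} -> size c <= k ->
  exists ev, faults_from k ev h c (w ++ t) + size c
             <= n + minn (count [pred x | x \notin c] B) g.
Proof.
move=> uV sV uB sB BV wB Ht; elim: w wB => [_|r w IH wB] h c uc cV ck.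
  by have [ev E] := Ht h c uc cV ck; exists ev; rewrite (leq_trans E) // leq_addr.
have rB : r \in B by apply: wB; rewrite mem_head.
have {}IH : forall h c, uniq c -> {subset c <= V} -> size c <= k ->
  exists ev, faults_from k ev h c (w ++ t) + size c
             <= n + minn (count [pred x | x \notin c] B) g.
  by apply: IH => x xw; apply: wB; rewrite inE xw orbT.
case: (boolP (r \in c)) => rc.
  have [ev E] := IH (rcons h r) c uc cV ck.
  have [ev' E'] := @offline_step h c r (w ++ t) r ev _ erefl.
  by exists ev'; rewrite cat_cons E' rc /serve rc.
have step c' (x : T) : serve k c x r = c' -> r \in c' -> uniq c' -> {subset c' <= V} -> size c' <= k ->
  (forall y, y \in B -> y \in c -> y \in c') ->
  exists ev, faults_from k ev h c ((r :: w) ++ t) + size c' <=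
     n.+1 + minn (count [pred x | x \notin c] B).-1 g.
  move=> sc rc' uc' c'V c'k cc'.
  have [ev E] := IH (rcons h r) c' uc' c'V c'k.
  have [ev' E'] := @offline_step h c r (w ++ t) x ev _ erefl.
  exists ev'; rewrite cat_cons E' rc add1n !addSn ltnS sc.
  apply: leq_trans E _; rewrite leq_add2l leq_min geq_minr andbT.
  apply: leq_trans (geq_minl _ _) _.
  rewrite -!size_filter -(@size_rem _ r) ?mem_filter ?inE ?rc ?rB //.
  apply: uniq_leq_size; first exact: filter_uniq.
  move=> y; rewrite mem_rem_uniq ?filter_uniq // !inE !mem_filter /= => /andP[yc' yB].
  rewrite yB andbT; apply/andP; split; first by apply: contraNneq yc' => ->.
  by apply: contra yc'; apply: cc'.
have cnt0 : 0 < count [pred x | x \notin c] B.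
  by rewrite -has_count; apply/hasP; exists r.
case: (ltnP (size c) k) => ck'.
  have [||||||ev E] := @step (r :: c) r; rewrite ?mem_head //=.
  - by rewrite /serve (negbTE rc) ck'.
  - by rewrite rc.
  - by move=> y; rewrite inE => /orP[/eqP->|/cV//]; apply: BV.
  - by move=> y _ yc; rewrite inE yc orbT.
  exists ev; rewrite addnS addSn ltnS in E; apply: leq_trans E _.
  by rewrite leq_add2l leq_min geq_minr andbT (leq_trans (geq_minl _ _)) // leq_pred.
have sck : size c = k by apply/eqP; rewrite eqn_leq ck.
have [x xc xB] : exists2 x, x \in c & x \notin B.
  apply/hasP; case: hasP => // nx.
  have cB : {subset c <= B}.
    by move=> y yc; apply/negPn/negP => yB; apply: nx; exists y.
  have [_ cB'] := uniq_min_size uc cB (eq_leq (etrans sB (esym sck))).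
  by move: rc; rewrite cB' rB.
have [||||||ev E] := @step (r :: rem x c) x; rewrite ?mem_head //=.
- by rewrite /serve (negbTE rc) sck ltnn xc.
- by rewrite rem_uniq // andbT; apply: contra rc; apply: mem_rem.
- by move=> y; rewrite inE => /orP[/eqP->|/mem_rem/cV//]; apply: BV.
- by rewrite size_rem // prednK ?sck ?leqnn // -sck; case: (c) xc.
- move=> y yB yc; rewrite inE mem_rem_uniq // inE yc andbT; apply/orP; right.
  by apply: contraNneq xB => <-.
exists ev; move: E; rewrite /= size_rem // prednK; last by case: (c) xc.
move=> E; apply: leq_trans E _.
(* A fault that fills an empty slot is paid by the growth of [size c]. Here the cache is full,
   exactly g pages of [V] lie outside it, and so the minimum is the count, which drops by one and
   pays for the fault. *)
have le_g : count [pred x | x \notin c] B <= g.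
  apply: leq_trans (_ : count [pred x | x \notin c] V <= g).
    by rewrite -size_filter; apply: uniq_sub_count;
      [exact: filter_uniq|move=> y; rewrite mem_filter => /andP[_ /BV]|exact: filter_all].
  by rewrite count_notin_sub // sV sck addKn.
by rewrite (minn_idPl le_g) -(prednK cnt0) addnS /= addSn ltnS leq_add2l geq_minl.
Qed.

(** Iterates [offline_block]. The summand [size c] is a potential, by which the initial filling of
    the cache costs at most k in total and every block at most g. *)
Lemma offline_blocks V g (ws : seq (seq T)) :
  uniq V -> size V = k + g ->
  (forall w, w \in ws -> exists B, [/\ uniq B, size B = k, {subset B <= V} & {subset w <= B}]) ->
  forall h c, uniq c -> {subset c <= V} -> size c <= k ->
  exists ev, faults_from k ev h c (flatten ws) + size c <= k + size ws * g.
Proof.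
move=> uV sV; elim: ws => [_|w ws IH Hws] h c uc cV ck /=.
  by exists (fun _ r => r); rewrite add0n addn0.
have [B [uB sB BV wB]] := Hws w (mem_head _ _).
have {}IH : forall h c, uniq c -> {subset c <= V} -> size c <= k ->
  exists ev, faults_from k ev h c (flatten ws) + size c <= k + size ws * g.
  by apply: IH => w' w'ws; apply: Hws; rewrite inE w'ws orbT.
have [ev E] := offline_block uV sV uB sB BV wB IH h uc cV ck.
exists ev; apply: leq_trans E _.
by rewrite mulSn addnCA addnC leq_add2r geq_minr.
Qed.

Lemma opt_le ev s : opt k s <= faults k ev s.
Proof. by rewrite /opt; case: ex_minnP => m _ /(_ (faults k ev s)); apply; apply/asboolP; exists ev. Qed.

Lemma opt_attained s : exists ev, faults k ev s = opt k s.
Proof. by rewrite /opt; case: ex_minnP => m /asboolP. Qed.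

End CacheDynamics.

(** * The partition into phases, and the optimum bounded below by new pages *)

Section Phases.
Variables (T : eqType) (k : nat).
Hypothesis k_gt0 : 0 < k.
Implicit Types (c h s q p : seq T).

Definition new_pages q p := size (undup [seq x <- p | x \notin q]).

(* [ps] is the sequence of the phases that follow a phase requesting [q]. *)
Fixpoint phased q (ps : seq (seq T)) : bool :=
  if ps is p :: ps' then
    [&& size (undup q) == k, if p is r :: _ then r \notin q else false,
        size (undup p) <= k & phased p ps']
  else true.

Fixpoint total_new q (ps : seq (seq T)) : nat :=
  if ps is p :: ps' then new_pages q p + total_new p ps' else 0.

(** For the induction the current phase is already under way: [q] holds its requests so far and [p]
    those that complete it. *)
Lemma phases_exist q s : size (undup q) <= k ->
  exists p ps, [/\ s = p ++ flatten ps, size (undup (q ++ p)) <= k & phased (q ++ p) ps].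
Proof.
elim: s q => [|r s IH] q qk; first by exists [::], [::]; rewrite cats0.
case: (boolP ((r \notin q) && (k <= size (undup q)))) => [/andP[rq kq]|trig].
  have [|p [ps [-> pk ph]]] := IH [:: r]; first by [].
  exists [::], ((r :: p) :: ps); rewrite cats0; split => //=.
  by rewrite eqn_leq qk kq rq; move: pk => /= ->.
have [|p [ps [-> pk ph]]] := IH (rcons q r).
  have [rq|rq] := boolP (r \in q).
    apply: leq_trans qk; apply: size_undup_sub => x.
    by rewrite mem_rcons inE => /orP[/eqP->|].
  move: trig; rewrite rq /= -ltnNge => qk'; apply: leq_trans qk'.
  rewrite -[X in _ <= X]/(size (r :: undup q)); apply: uniq_leq_size; rewrite ?undup_uniq //.
  by move=> x; rewrite mem_undup mem_rcons !inE mem_undup.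
by exists (r :: p), ps; rewrite -cat_rcons.
Qed.

Lemma new_pages_le q c p : uniq c ->
  new_pages q p <= count [pred x | x \notin c] (undup p) + count [pred x | x \notin q] c.
Proof.
move=> uc; rewrite -!size_filter -size_cat; apply: uniq_leq_size; first exact: undup_uniq.
move=> x; rewrite mem_undup mem_cat !mem_filter mem_undup /= => /andP[xq xp].
by rewrite xq xp andbT /= orNb.
Qed.

Lemma misses_le_faults ev h c p t :
  count [pred x | x \notin c] (undup p) <= faults_from k ev h c p + t.
Proof.
apply: leq_trans (leq_addr _ _); rewrite -size_filter; apply: size_le_faults.
- exact/filter_uniq/undup_uniq.
- by move=> x; rewrite mem_filter mem_undup => /andP[].
- by move=> x; rewrite mem_filter => /andP[].
Qed.

(* Pages of the cache outside a full phase [p] are balanced by pages of [p] missing at its start. *)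
Lemma leftover_le_faults ev h c p : uniq c -> size c <= k -> size (undup p) = k ->
  count [pred x | x \notin p] (cache_from k ev h c p) <= faults_from k ev h c p.
Proof.
move=> uc ck pk; rewrite -[leqRHS]addn0; apply: leq_trans (misses_le_faults ev h c p 0).
apply: leq_trans (count_swap uc (undup_uniq p) _); last by rewrite pk.
rewrite -!size_filter; apply: uniq_leq_size; first exact/filter_uniq/cache_from_uniq.
move=> x; rewrite !mem_filter /= mem_undup => /andP[xp /cache_from_sub].
by rewrite mem_cat (negbTE xp).
Qed.

(** A new page of a phase is missing at its start or lies in the cache without having been requested
    in the previous phase. The first kind is bounded by the faults of this phase, the second by
    those of the previous one, so each fault is used at most twice. *)
Lemma total_new_le ev q ps h c : uniq c -> size c <= k -> phased q ps ->
  total_new q ps <= 2 * faults_from k ev h c (flatten ps)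
                    + (if ps is [::] then 0 else count [pred x | x \notin q] c).
Proof.
elim: ps q h c => // p ps IH q h c uc ck /= /and4P[_ _ pk ph].
rewrite faults_from_cat.
have := IH p (h ++ p) (cache_from k ev h c p) (cache_from_uniq k ev h p uc)
  (size_cache_from ev h p k_gt0 ck) ph.
have := misses_le_faults ev h c p 0; have := new_pages_le q p uc.
case: ps ph {IH} => [|p' ps]; first by move=> _ /=; lia.
by case/andP=> /eqP pk' _; have := leftover_le_faults ev h uc ck pk'; lia.
Qed.

Lemma total_new_le_opt s : exists p ps,
  [/\ s = p ++ flatten ps, size (undup p) <= k, phased p ps &
      size (undup p) + total_new p ps <= 2 * opt k s].
Proof.
have [p [ps [-> pk ph]]] := @phases_exist [::] s (leq0n _).
exists p, ps; split => //; have [ev <-] := opt_attained k (p ++ flatten ps).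
rewrite /faults faults_from_cat.
have := total_new_le ev ([::] ++ p) (@cache_from_uniq _ k ev [::] [::] p isT)
  (@size_cache_from _ k ev [::] [::] p k_gt0 (leq0n _)) ph.
have := misses_le_faults ev [::] [::] p 0.
rewrite (eq_count (a2 := predT)) // count_predT.
case: ps ph => [|p' ps]; first by move=> _ /=; lia.
by case/andP=> /eqP pk' _; have := @leftover_le_faults ev [::] [::] p isT (leq0n _) pk'; rewrite /=; lia.
Qed.

End Phases.

(** * Walks, and the expected cost of an online algorithm *)

Section Walks.
Variables (T : eqType) (e : rel T).
Hypothesis e_sym : symmetric e.
Implicit Types (a x y : T) (K w : seq T).

Definition adj x y := (x == y) || e x y.

Lemma adj_refl x : adj x x. Proof. by rewrite /adj eqxx. Qed.

Lemma adj_sym : symmetric adj.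
Proof. by move=> x y; rewrite /adj eq_sym e_sym. Qed.

Definition reach K a x := exists w, [/\ path adj a w, {subset w <= K} & last a w = x].

Definition connected K a := a \in K /\ forall x, x \in K -> reach K a x.

Lemma reach_refl K a : reach K a a. Proof. by exists [::]. Qed.

Lemma reach_step K a x y : y \in K -> adj x y -> reach K a x -> reach K a y.
Proof.
move=> yK xy [w [aw wK xE]]; exists (rcons w y); split; rewrite ?last_rcons //.
  by rewrite rcons_path aw xE xy.
by move=> z; rewrite mem_rcons inE => /orP[/eqP->|/wK].
Qed.

Lemma reach_sub K K' a x : {subset K <= K'} -> reach K a x -> reach K' a x.
Proof. by move=> KK' [w [aw wK xE]]; exists w; split => // y /wK/KK'. Qed.

Lemma connected_cons K a x : connected K a -> has (adj x) K -> connected (x :: K) a.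
Proof.
move=> [aK Kr] /hasP[y yK xy]; split=> [|z]; first by rewrite inE aK orbT.
have KK' : {subset K <= x :: K} by move=> u uK; rewrite inE uK orbT.
rewrite inE => /orP[/eqP->|/Kr]; last exact: reach_sub.
apply: (reach_step _ (x := y)); rewrite ?mem_head ?(adj_sym y) //.
exact: reach_sub (Kr y yK).
Qed.

Lemma eq_connected K K' a : K =i K' -> connected K a -> connected K' a.
Proof.
move=> E [aK Kr]; split; first by rewrite -E.
by move=> x; rewrite -E => /Kr; apply: reach_sub => y; rewrite E.
Qed.

(** Walk from [a] to each page of [K] in turn and back along the reversed walk. *)
Lemma closed_walk K a : connected K a ->
  exists w, [/\ path adj a w, last a w = a & w =i K].
Proof.
move=> [aK Kr].
suff [w [aw al wK Kw]] : exists w, [/\ path adj a w, last a w = a, {subset w <= K} & {subset K <= w}].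
  by exists w; split => // x; apply/idP/idP => [/wK|/Kw].
have: {subset K <= K} by [].
elim: {1 4}K => [_|x L IH LK]; first by exists [::].
have [|w [aw al wK Lw]] := IH; first by move=> y yL; apply: LK; rewrite inE yL orbT.
have [q [aq qK xE]] := Kr x (LK x (mem_head _ _)).
(* The repetition of [a] is a legal step, as [adj] is reflexive, and it makes the walk visit its
   target even if [q] is empty. *)
exists (a :: q ++ rev (belast a q) ++ w); rewrite /= adj_refl !last_cat cat_path aq /=; split.
- rewrite cat_path rev_path -(eq_path (e := adj)); last by move=> u v; rewrite adj_sym.
  by rewrite aq; case: (q) => //= z q'; rewrite rev_cons last_rcons.
- by case: (q) => //= z q'; rewrite rev_cons last_rcons.
- move=> y; rewrite inE !mem_cat mem_rev => /or4P[/eqP->//|/qK//| |/wK//].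
  by move/mem_belast; rewrite inE => /orP[/eqP->|/qK].
- move=> y; rewrite [y \in x :: L]inE => /orP[/eqP->|/Lw yw]; last by rewrite inE !mem_cat yw !orbT.
  by rewrite -cat_cons mem_cat -xE mem_last.
Qed.

Lemma reach_walk a w x : path adj a w -> x \in a :: w -> reach (a :: w) a x.
Proof.
move=> aw; rewrite inE => /orP[/eqP->|xw]; first exact: reach_refl.
case/path.splitP: xw aw => p1 p2; rewrite cat_path => /andP[ap1 _].
exists (rcons p1 x); split; rewrite ?last_rcons // => y yp1.
by rewrite inE mem_cat yp1 orbT.
Qed.

End Walks.

(** * Measurability and expectation of the number of faults *)

Section ExpectedCost.
Variables (R : realType) (T : eqType) (k : nat).
Local Open Scope ring_scope.

(** Only the finitely many values in [L] are told apart, so measurability of the events [X w = x]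
    suffices over an arbitrary type of pages. Here [L] will be the cache. *)
Lemma measurable_mem_case d (W : measurableType d) (X : W -> T) (f : T -> W -> R) (g : W -> R) (L : seq T) :
  (forall x, measurable [set w | X w = x]%classic) ->
  (forall x, measurable_fun [set: W] (f x)) -> measurable_fun [set: W] g ->
  measurable_fun [set: W] (fun w => if X w \in L then f (X w) w else g w).
Proof.
move=> mX mf mg; elim: L => [|x L IH] //.
rewrite (_ : (fun w => _) = (fun w => if X w == x then f x w
    else if X w \in L then f (X w) w else g w)); last first.
  by apply/funext => w; rewrite inE; case: eqVneq => // ->.
apply: measurable_fun_ifT => //; apply: (measurable_fun_bool true).
rewrite setTI (_ : _ @^-1` _ = [set w | X w = x])%classic //.
by apply/seteqP; split => w /= /eqP.
Qed.

Lemma measurable_faults d (W : measurableType d) (ev : W -> rule T) h c s :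
  (forall h r x, measurable [set w | ev w h r = x]%classic) ->
  measurable_fun [set: W] (fun w => (faults_from k (ev w) h c s)%:R : R).
Proof.
move=> mev; elim: s h c => [|r s IH] h c /=; first exact: measurable_cst.
under eq_fun do rewrite natrD.
apply: measurable_funD; first exact: measurable_cst.
rewrite /serve; case: (r \in c); first exact: IH.
case: (size c < k)%N; first exact: IH.
pose F y (w : W) : R := (faults_from k (ev w) (rcons h r) (r :: rem y c) s)%:R.
rewrite (_ : (fun w => _) = (fun w => if ev w h r \in c then F (ev w h r) w else F (head r c) w));
  last by apply/funext => w; case: ifP.
by apply: measurable_mem_case => [x|x|]; [exact: mev|exact: IH|exact: IH].
Qed.

Lemma expectationD_ge0 d (W : measurableType d) (P : probability W R) (X Y : W -> R) :
  measurable_fun [set: W] X -> measurable_fun [set: W] Y ->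
  (forall w, 0 <= X w) -> (forall w, 0 <= Y w) ->
  ('E_P[fun w => (X w + Y w)%R] = 'E_P[X] + 'E_P[Y])%E.
Proof.
move=> mX mY X0 Y0; rewrite unlock /= -ge0_integralD //.
- by move=> w _; rewrite lee_fin.
- exact/measurable_EFinP.
- by move=> w _; rewrite lee_fin.
- exact/measurable_EFinP.
Qed.

Lemma faults_le_size ev h c s : (faults_from k (T:=T) ev h c s <= size s)%N.
Proof. by elim: s h c => //= r s IH h c; rewrite -add1n leq_add ?leq_b1. Qed.

(** All that the adversary uses of a randomized algorithm: its costs are finite, as there is at most
    one fault per request, and an inequality valid for every deterministic rule passes to the
    expectations. *)
Lemma online_cost_real cost : @online_cost R T k cost ->
  exists f : seq T -> R, [/\ forall s, cost s = (f s)%:E, forall s, 0 <= f s &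
    forall s w1 w2 g,
      (forall ev, (2 * faults k ev s + g <= faults k ev (s ++ w1) + faults k ev (s ++ w2))%N) ->
      2 * f s + g%:R <= f (s ++ w1) + f (s ++ w2)].
Proof.
case=> d [W [P [ev [mev Ecost]]]].
pose X s (w : W) : R := (faults k (ev w) s)%:R.
have mX s : measurable_fun [set: W] (X s) by exact: measurable_faults.
have X0 s w : 0 <= X s w by exact: ler0n.
have fin s : ('E_P[X s])%E \is a fin_num.
  rewrite ge0_fin_numE ?expectation_ge0 //.
  apply: (@le_lt_trans _ _ ('E_P[cst (size s)%:R])%E); last by rewrite expectation_cst ltry.
  apply: expectation_le => //.
  by apply: aeW => w; rewrite ler_nat faults_le_size.
exists (fun s => fine ('E_P[X s])%E); split => [s|s|s w1 w2 g H].
- by rewrite Ecost fineK.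
- by apply: fine_ge0; apply: expectation_ge0.
have mcst (n : nat) : measurable_fun [set: W] (fun=> n%:R : R) by exact: measurable_cst.
rewrite -lee_fin !EFinD EFinM !fineK // mule_natl mule2n.
rewrite -(expectation_cst P g%:R) -!expectationD_ge0 //; last 2 first.
- exact: measurable_funD.
- by move=> w; apply: addr_ge0.
apply: expectation_le => //.
- by apply: measurable_funD => //; apply: measurable_funD.
- exact: measurable_funD.
- by move=> w; rewrite !addr_ge0.
- by move=> w; rewrite !addr_ge0.
- apply: aeW => w /=; rewrite /X -!natrD ler_nat; have := H (ev w); lia.
Qed.

End ExpectedCost.

(** * The halving adversary *)

Section HalvingLowerBound.
Variables (R : realType) (T : eqType) (k g : nat) (e : rel T).
Hypothesis e_sym : symmetric e.
Variables (a : T) (K S : seq T).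
Hypothesis uKS : uniq (K ++ S).
Hypothesis sKS : size (K ++ S) = k + g.
Hypothesis cK : connected e K a.
Hypothesis before : forall S1 x S2, S = S1 ++ x :: S2 -> has (adj e x) (K ++ S1).
Hypothesis after : forall S1 x S2, S = S1 ++ x :: S2 -> has (adj e x) (K ++ S2).

(* The pages requested so far; the positions i <= n < j of [S] are still to be searched. *)
Let M i j := K ++ take i S ++ drop j S.

Let connected_prefix i : connected e (K ++ take i S) a.
Proof.
elim: i => [|i IH]; first by rewrite take0 cats0.
case: (ltnP i (size S)) => iS; last first.
  by move: IH; rewrite !take_oversize // leqW.
pose x := nth a S i.
have E : S = take i S ++ x :: drop i.+1 S by rewrite -drop_nth // cat_take_drop.
apply: eq_connected (connected_cons e_sym IH (before E)) => y.
by rewrite (take_nth a) // inE !mem_cat mem_rcons inE orbCA.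
Qed.

(** Add the suffix from its last page backwards: each page is adjacent to [K] or to a later one. *)
Let connected_M i j : connected e (M i j) a.
Proof.
rewrite /M; move eN : (size S - j) => N; elim: N j eN => [|N IH] j eN.
  by rewrite drop_oversize ?cats0 -?subn_eq0 ?eN.
have jS : j < size S by rewrite -subn_gt0 eN.
pose x := nth a S j.
have E : S = take j S ++ x :: drop j.+1 S by rewrite -drop_nth // cat_take_drop.
have h : has (adj e x) (K ++ take i S ++ drop j.+1 S).
  by have := after E; rewrite !has_cat => /orP[->|->] //; rewrite !orbT.
have {}IH := IH j.+1 (_ : _ = N); rewrite subnS eN in IH.
apply: eq_connected (connected_cons e_sym (IH erefl) h) => y.
by rewrite (drop_nth a jS) inE !mem_cat inE -/x; case: (y == x); rewrite ?orbT.
Qed.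

Local Open Scope ring_scope.
Variables (f : seq T -> R).
Hypothesis f_ge0 : forall s, 0 <= f s.
Hypothesis f_round : forall s w1 w2 n,
  (forall ev, (2 * faults k ev s + n <= faults k ev (s ++ w1) + faults k ev (s ++ w2))%N) ->
  2 * f s + n%:R <= f (s ++ w1) + f (s ++ w2).

(** Both walks start from the same cache, which misses at least g of the k + g pages. A missing page
    faults in [w1] if it occurs there, and otherwise in [w2]. *)
Let two_walks s w1 w2 : {subset K ++ S <= w1 ++ w2} -> (0 < k)%N ->
  2 * f s + g%:R <= f (s ++ w1) + f (s ++ w2).
Proof.
move=> KSw k0; apply: f_round => ev; rewrite /faults !faults_from_cat.
set c := cache_from k ev [::] [::] s.
pose X := [seq x <- K ++ S | x \notin c].
have gX : (g <= size X)%N.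
  have sc : (size c <= k)%N by exact: size_cache_from.
  have := count_predC [pred x | x \notin c] (K ++ S); rewrite -size_filter -/X sKS => E.
  have : (count (predC [pred x | x \notin c]) (K ++ S) <= size c)%N.
    rewrite -size_filter; apply: uniq_leq_size; first exact: filter_uniq.
    by move=> x; rewrite mem_filter /= negbK => /andP[].
  by lia.
have X1 : (size [seq x <- X | x \in w1] <= faults_from k ev ([::] ++ s) c w1)%N.
  apply: size_le_faults; first by rewrite !filter_uniq.
  - by move=> x; rewrite mem_filter => /andP[].
  - by move=> x; rewrite !mem_filter => /and3P[].
have X2 : (size [seq x <- X | x \notin w1] <= faults_from k ev ([::] ++ s) c w2)%N.
  apply: size_le_faults; first by rewrite !filter_uniq.
  - move=> x; rewrite !mem_filter => /and3P[xw1 _ /KSw]; by rewrite mem_cat (negbTE xw1).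
  - by move=> x; rewrite !mem_filter => /and3P[].
have E : (size [seq x <- X | x \in w1] + size [seq x <- X | x \notin w1] = size X)%N.
  by rewrite -[RHS](count_predC [in w1] X) -!size_filter.
by rewrite /= in X1 X2 *; lia.
Qed.

Hypothesis k_gt0 : (0 < k)%N.

(** One search by t halvings. The two continuations together add at least g to the expected cost, so
    the dearer one adds at least g / 2. The assumption on j - i leaves g pages unsearched at the
    end. *)
Let search t i j s : (i <= j <= size S)%N -> (g * 2 ^ t <= j - i)%N ->
  path (adj e) a s -> last a s = a ->
  exists w i' j', [/\ path (adj e) a w, last a w = a, {subset w <= M i' j'},
    [&& i <= i', i' + g <= j' & j' <= j]%N & f s + t%:R * (g%:R / 2) <= f (s ++ w)].
Proof.
elim: t i j s => [|t IH] i j s /andP[ij jS] gij ps ls.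
  exists [::], i, j; split => //; last by rewrite cats0 mul0r addr0.
  by rewrite leqnn; lia.
pose m := (i + (j - i)./2)%N.
have hm := half_leq (leqnn (j - i)).
have gm : (g * 2 ^ t <= (j - i)./2)%N.
  by rewrite geq_half_double -muln2 -mulnA -expnSr.
(* [w1] extends the requested prefix up to the midpoint, [w2] the requested suffix down to it. *)
have [w1 [p1 l1 e1]] := closed_walk e_sym (connected_M m j).
have [w2 [p2 l2 e2]] := closed_walk e_sym (connected_M i m).
have half2 : ((j - i)./2 <= j - i)%N by rewrite -{2}[(j - i)%N]odd_double_half -addnn; lia.
have half2' : ((j - i)./2 <= j - i - (j - i)./2)%N by rewrite -{2}[(j - i)%N]odd_double_half -addnn; lia.
have cover : {subset K ++ S <= w1 ++ w2}.
  move=> x; rewrite !mem_cat e1 e2 /M !mem_cat -{1}(cat_take_drop m S) mem_cat.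
  by case/or3P => ->; rewrite ?orbT.
have := two_walks s cover k_gt0.
suff ext i1 j1 w : (i <= i1)%N -> (i1 <= j1)%N -> (j1 <= j)%N -> (g * 2 ^ t <= j1 - i1)%N ->
    path (adj e) a w -> last a w = a -> w =i M i1 j1 -> f s + g%:R / 2 <= f (s ++ w) ->
    exists w i' j', [/\ path (adj e) a w, last a w = a, {subset w <= M i' j'},
    [&& i <= i', i' + g <= j' & j' <= j]%N & f s + t.+1%:R * (g%:R / 2) <= f (s ++ w)].
  move=> two; have [le1|gt1] := lerP (f s + g%:R / 2) (f (s ++ w1)).
    by apply: (ext m j w1) => //; rewrite /m; lia.
  by apply: (ext i m w2) => //; rewrite /m; first [lia|lra].
move=> ii1 ij1 jj1 gij1 pw lw ew fw.
have [||||w' [i' [j' [pw' lw' sw' /and3P[h1 h2 h3] fw']]]] := IH i1 j1 (s ++ w).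
- by rewrite ij1 (leq_trans jj1).
- by [].
- by rewrite cat_path ls ps.
- by rewrite last_cat ls.
exists (w ++ w'), i', j'; split.
- by rewrite cat_path lw pw.
- by rewrite last_cat lw.
(* The requested part grows as the interval shrinks, so the earlier walk stays within the final
   [M i' j']. *)
- move=> x; rewrite mem_cat => /orP[|/sw'//]; rewrite ew /M !mem_cat.
  case/or3P => [->//|xt|xd]; apply/orP; right; apply/orP; [left|right].
    by rewrite -(subnKC h1) takeD mem_cat xt.
  by move: xd; rewrite -(subnKC h3) addnC -drop_drop => /mem_drop.
- by rewrite (leq_trans ii1) // h2 (leq_trans h3).
- by rewrite catA (le_trans _ fw') // -[t.+1]addn1 natrD mulrDl mul1r; lra.
Qed.

(** N searches, each restarted on the whole of [S]. A search leaves g pages out, so its requests fit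
    into k pages, as [offline_blocks] demands. *)
Let cycles t N : (g * 2 ^ t <= size S)%N -> exists ws,
  [/\ path (adj e) a (flatten ws) /\ last a (flatten ws) = a, size ws = N,
      forall w, w \in ws ->
        exists B, [/\ uniq B, size B = k, {subset B <= K ++ S} & {subset w <= B}] &
      N%:R * (t%:R * (g%:R / 2)) <= f (flatten ws)].
Proof.
move=> gS; elim: N => [|N [ws [[pw lw] sw bw fw]]]; first by exists [::]; split; rewrite ?mul0r.
have [||w [i [j [pw' lw' sw' /and3P[_ h2 h3] fw']]]] := @search t 0 (size S) _ _ _ pw lw.
- by rewrite leqnn.
- by rewrite subn0.
exists (rcons ws w); rewrite flatten_rcons size_rcons sw; split => //.
- by rewrite cat_path last_cat lw pw.
- move=> v; rewrite mem_rcons inE => /orP[/eqP->|/bw//].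
  (* These are g pages that the search has not requested; they exist because i + g <= j. *)
  pose Z := take g (drop i S).
  have ZS : {subset Z <= S} by move=> x /mem_take/mem_drop.
  have uS : uniq S by move: uKS; rewrite cat_uniq => /and3P[].
  exists [seq x <- K ++ S | x \notin Z]; split.
  + exact: filter_uniq.
  + rewrite size_filter count_notin_sub //.
    * by rewrite sKS size_takel ?addnK // size_drop; lia.
    * by rewrite take_uniq ?drop_uniq.
    * by move=> x /ZS xS; rewrite mem_cat xS orbT.
  + by move=> x; rewrite mem_filter => /andP[].
  + move=> x /sw'; rewrite mem_filter /M !mem_cat.
    have uS' : uniq (take i S ++ Z ++ drop g (drop i S)).
      by rewrite cat_take_drop cat_take_drop.
    case/or3P => [xK|xt|xd].
    * rewrite xK andbT; apply/negP => /ZS xS; move: uKS.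
      by rewrite cat_uniq => /and3P[_ /negP h _]; apply: h; apply/hasP; exists x.
    * rewrite (mem_take xt) orbT andbT; apply/negP => xZ.
      move: uS'; rewrite cat_uniq => /and3P[_ /negP h _]; apply: h; apply/hasP.
      by exists x; rewrite // mem_cat xZ.
    * rewrite (mem_drop xd) orbT andbT; apply/negP => xZ.
      move: uS'; rewrite !cat_uniq => /and3P[_ _ /and3P[_ /negP h _]]; apply: h; apply/hasP.
      exists x => //; rewrite drop_drop.
      by move: xd; rewrite -(subnKC h2) addnC -drop_drop (addnC g) => /mem_drop.
- rewrite -addn1 natrD mulrDl mul1r; apply: le_trans fw'.
  by rewrite lerD2r.
Qed.

Variables (r C : R).
Hypothesis f_le : forall s, in_paths e s -> f s <= r * (opt k s)%:R + C.
Hypotheses (r_ge0 : 0 <= r) (g_gt0 : (0 < g)%N).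

(** N searches cost the algorithm at least N t g / 2 and the optimum at most k + N g. If t / 2
    exceeded r, then N could be chosen so large that the constants r k + C do not make up for the
    difference. *)
Lemma halving_lower_bound t : (g * 2 ^ t <= size S)%N -> t%:R <= 2 * r.
Proof.
move=> gS; rewrite leNgt; apply/negP => tr.
have g0 : 1 <= g%:R :> R by rewrite ler1n.
have [N hN] : exists N : nat, r * k%:R + C < N%:R * (t%:R / 2 - r).
  have d0 : 0 < t%:R / 2 - r by lra.
  exists (Num.bound `|(r * k%:R + C) / (t%:R / 2 - r)|).
  by rewrite -ltr_pdivrMr //; apply: le_lt_trans (ler_norm _) _; apply: archi_boundP.
have [ws [[pw _] sw bw fw]] := @cycles t N gS.
have := offline_blocks uKS sKS bw [::] (isT : uniq [::]) _ (leq0n _).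
case=> // ev; rewrite addn0 sw => Eev.
have := le_trans fw (f_le (path_sorted pw)).
have : (opt k (flatten ws))%:R <= k%:R + N%:R * g%:R :> R.
  by rewrite -natrM -natrD ler_nat (leq_trans (opt_le _ ev _)).
move=> /(ler_wpM2l r_ge0) h1 h2.
have h3 := le_trans h2 (lerD h1 (lexx C)).
have : N%:R * (t%:R / 2 - r) * g%:R <= r * k%:R + C by lra.
have N0 : 0 <= N%:R * (t%:R / 2 - r) by rewrite mulr_ge0 //; lra.
have := ler_peMr N0 g0.
lra.
Qed.

End HalvingLowerBound.

(** * Rooted spanning trees *)

Lemma count_sum (T : Type) (b : pred T) s : count b s = \sum_(v <- s) (b v : nat).
Proof. by elim: s => [|x s IH]; rewrite ?big_nil // big_cons -IH. Qed.

Section RootedTree.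
Variables (T : eqType) (p : seq T) (g : rel T) (root : T).
Hypothesis g_tree : spanning_tree p g.
Hypothesis root_p : root \in p.

Lemma gedge_irr (q : seq T) u : gedge q u u = false.
Proof. by rewrite /gedge eqxx. Qed.

Lemma mem_zip (q1 q2 : seq T) u v : (u, v) \in zip q1 q2 -> (u \in q1) && (v \in q2).
Proof.
elim: q1 q2 => [|x q1 IH] [|y q2] //=; rewrite !inE => /orP[/eqP[-> ->]|/IH/andP[-> ->]].
  by rewrite !eqxx.
by rewrite !orbT.
Qed.

Lemma gedge_mem (q : seq T) u v : gedge q u v -> (u \in q) && (v \in q).
Proof. by case/andP=> _ /orP[] /mem_zip/andP[-> /mem_behead ->]. Qed.

Lemma tree_neq u v : g u v -> u != v.
Proof.
by case: g_tree => _ ge _ _ /ge guv; apply: contraTneq guv => ->; rewrite gedge_irr.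
Qed.

Lemma tree_mem u v : g u v -> (u \in p) && (v \in p).
Proof. by case: g_tree => _ ge _ _ /ge/gedge_mem. Qed.

Let tree_walk v n := `[< exists q, [/\ path g root q, last root q = v & size q = n] >].

Let depth v := if pselect (exists n, tree_walk v n) is left h then ex_minn h else 0.

Let depth_le q : path g root q -> depth (last root q) <= size q.
Proof.
move=> pq; rewrite /depth; case: pselect => // h; case: ex_minnP => n _; apply.
by apply/asboolP; exists q.
Qed.

Let depth_walk v : v \in p -> exists q, [/\ path g root q, last root q = v & size q = depth v].
Proof.
move=> vp; rewrite /depth; case: pselect => [h|[]]; first by case: ex_minnP => n /asboolP.
case: g_tree => _ _ + _ => /(_ root v); rewrite !mem_undup => /(_ root_p vp) [q [pq qv]].
by exists (size q); apply/asboolP; exists q.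
Qed.

(** The parent is the last but one page of a shortest walk from the root. The hypotheses stand below
    the quantifier so that [choice] yields a total function. *)
Let parent_exists v : exists u, v \in p -> v != root -> g v u /\ depth u < depth v.
Proof.
have [vp|] := boolP (v \in p); last by exists v.
have [q [pq qv sq]] := depth_walk vp; exists (last root (belast root q)).
case/lastP: q pq qv sq => [|q u]; first by move=> _ <- _ _; rewrite eqxx.
rewrite rcons_path last_rcons size_rcons belast_rcons /= => /andP[pq gq] uv <- _ _; subst u.
by case: g_tree => gs _ _ _; rewrite gs gq ltnS; split=> //; apply: depth_le.
Qed.

(** On a shortest walk to [u], a page at least as deep as [u] can only be the end, and the end [u]
    differs from [v]. *)
Let short_walk u v : g u v -> depth u <= depth v ->
  exists q, [/\ path g root q, last root q = u & v \notin root :: q].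
Proof.
move=> guv duv; have /andP[up vp] := tree_mem guv.
have [q [pq qu sq]] := depth_walk up; exists q; split=> //; rewrite inE negb_or.
apply/andP; split.
  apply: contraTneq duv => vr; rewrite -ltnNge vr.
  apply: leq_ltn_trans (@depth_le [::] isT) _; rewrite -sq.
  by case: (q) qu => //= ru; have := tree_neq guv; rewrite vr ru eqxx.
apply/negP => vq; case/path.splitP: vq pq qu sq => q1 q2; rewrite cat_path => /andP[/depth_le].
rewrite last_rcons size_rcons last_cat last_rcons size_cat size_rcons => dv _ lq sq.
have : size q2 = 0 by lia.
by move/size0nil => q20; have := tree_neq guv; rewrite -lq q20 eqxx.
Qed.

(* Two neighbours of v no farther from the root than v are joined by a path avoiding v. *)
Let upper_neighbour_unique u w v : g u v -> depth u <= depth v ->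
  g w v -> depth w <= depth v -> u = w.
Proof.
move=> guv du gwv dw; apply/eqP; apply: contraT => uw.
have [qu [pu lu vu]] := short_walk guv du; have [qw [pw lw vw]] := short_walk gwv dw.
have [gs _ _ acyclic] := g_tree.
pose q := rev (belast root qu) ++ qw.
have lr : last u (rev (belast root qu)) = root.
  by rewrite -lu; case: (qu) => //= z q'; rewrite rev_cons last_rcons.
have pq : path g u q.
  rewrite cat_path lr pw andbT -lu rev_path.
  by rewrite -(eq_path (e := g)) // => x y; rewrite gs.
have lq : last u q = w by rewrite last_cat lr.
have vq : v \notin u :: q.
  rewrite inE mem_cat mem_rev eq_sym !negb_or (tree_neq guv) /=.
  apply/andP; split; first by apply: contra vu => /mem_belast.
  by apply: contra vw; rewrite inE => ->; rewrite orbT.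
case/shortenP: pq lq => q' pq' uq' sub lq'.
have vq' : v \notin u :: q'.
  by apply: contra vq; rewrite !inE => /orP[->//|/sub ->]; rewrite orbT.
(* The page [v] followed by a repetition-free walk from [u] to [w] that avoids [v] closes up to a
   cycle of at least three pages. *)
have := acyclic (v :: u :: q'); rewrite (cons_uniq v) vq' uq'.
case: q' pq' lq' {uq' sub vq'} => [|z q'] pq' lq'; first by rewrite -lq' /= eqxx in uw.
move=> /(_ isT); suff -> : cycle g [:: v, u, z & q'] by move=> /(_ isT).
rewrite -[cycle _ _]/(path g v (rcons (u :: z :: q') v)) rcons_path; apply/andP; split.
  by rewrite -[path _ _ _]/(g v u && path g u (z :: q')) gs guv.
by rewrite -[last _ _]/(last u (z :: q')) lq'.
Qed.

Lemma rooted_tree : exists (d : T -> nat) (pa : T -> T),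
  (forall v, v \in p -> v != root -> g v (pa v) /\ d (pa v) < d v) /\
  (forall u v, g u v -> (v != root) && (pa v == u) || (u != root) && (pa u == v)).
Proof.
have [pa Hpa] := choice parent_exists; exists depth, pa; split=> // u v.
have gs : symmetric g by case: g_tree.
suff W x y : g x y -> depth x <= depth y -> (y != root) && (pa y == x).
  move=> guv; case/orP: (leq_total (depth u) (depth v)) => h; first by rewrite W.
  by rewrite (W v u) ?orbT // gs.
move=> gxy dxy; have /andP[xp yp] := tree_mem gxy.
have yr : y != root.
  have [q [_ _]] := short_walk gxy dxy; rewrite inE negb_or; by case/andP.
have [gpa dpa] := Hpa y yp yr; rewrite yr /=; apply/eqP.
by apply: (upper_neighbour_unique (v := y)); rewrite // 1?gs // ltnW.
Qed.

Variables (d : T -> nat) (pa : T -> T).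
Hypothesis pa_spec : forall v, v \in p -> v != root -> g v (pa v) /\ d (pa v) < d v.
Hypothesis pa_edge : forall u v, g u v ->
  (v != root) && (pa v == u) || (u != root) && (pa u == v).

Definition child v u := (u != root) && (pa u == v).
Definition nchildren v := count (child v) (undup p).

Lemma tree_adjE v u : v \in p -> u \in p -> g v u = child v u || child u v.
Proof.
move=> vp up; apply/idP/idP; first by move/pa_edge.
have gs : symmetric g by case: g_tree.
case/orP => /andP[r0 /eqP <-]; first by rewrite gs; case: (pa_spec up r0).
by case: (pa_spec vp r0).
Qed.

Lemma degE v : v \in p -> count (g v) (undup p) = nchildren v + (v != root).
Proof.
move=> vp; have -> : (v != root) = count [pred u | child u v] (undup p) :> nat.
  rewrite /child; case: (boolP (v != root)) => vr /=; last by rewrite count_pred0.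
  rewrite (eq_count (a2 := pred1 (pa v))) ?count_uniq_mem ?undup_uniq // ?mem_undup.
    by have [/tree_mem/andP[_ ->]] := pa_spec vp vr.
  by move=> u; rewrite /= eq_sym.
rewrite -count_predUI [X in _ + X](_ : _ = 0); last first.
  apply/eqP; rewrite -leqn0 leqNgt -has_count; apply/hasPn => u; rewrite mem_undup => up /=.
  apply/negP => /andP[/andP[ur /eqP E1] /andP[vr /eqP E2]].
  have := pa_spec vp vr; have := pa_spec up ur; rewrite E1 E2; lia.
by rewrite addn0; apply: eq_in_count => u; rewrite mem_undup => up; rewrite tree_adjE.
Qed.

(** Double counting: a page is a child of at most one page, and the root of none. *)
Lemma sum_nchildren : \sum_(v <- undup p) nchildren v < size (undup p).
Proof.
rewrite (eq_bigr (fun v => \sum_(u <- undup p) child v u)); last first.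
  by move=> v _; apply: count_sum.
rewrite exchange_big /=.
apply: (@leq_ltn_trans (\sum_(u <- undup p) (u != root))).
  apply: leq_sum => u _; rewrite /child; case: (u != root) => /=; last by rewrite big1.
  rewrite (eq_bigr (fun v => (v == pa u : nat))); last by move=> v _; rewrite eq_sym.
  have -> : \sum_(v <- undup p) (v == pa u : nat) = count (pred1 (pa u)) (undup p).
    by rewrite count_sum.
  by rewrite count_uniq_mem ?undup_uniq // leq_b1.
have -> : \sum_(u <- undup p) (u != root : nat) = count (predC1 root) (undup p).
  by rewrite count_sum.
rewrite -(count_predC (predC1 root) (undup p)) -[ltnLHS]addn0 ltn_add2l -has_count.
by apply/hasP; exists root; rewrite ?mem_undup //= eqxx.
Qed.

(** At each vertex, [degree is not 2] + 1 is at most 2 [no child] + (number of children) + [root].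
    Summing over the tree and applying [sum_nchildren] gives the claim. *)
Lemma branching_le_leaves : count [pred v | count (g v) (undup p) != 2] (undup p)
  <= 2 * count [pred v | nchildren v == 0] (undup p).
Proof.
suff : count [pred v | count (g v) (undup p) != 2] (undup p) + size (undup p) <=
    2 * count [pred v | nchildren v == 0] (undup p) + \sum_(v <- undup p) nchildren v
    + count (pred1 root) (undup p).
  have := sum_nchildren; rewrite count_uniq_mem ?undup_uniq // mem_undup root_p; lia.
rewrite -[size _]sum1_size !count_sum big_distrr /= -!big_split /=.
rewrite !(big_seq_cond xpredT); apply: leq_sum => v; rewrite andbT mem_undup => vp.
rewrite degE //; case: (v =P root) => _ /=; case: (nchildren v) => [|[|n]] /=; lia.
Qed.

End RootedTree.

(** * Harmonic numbers and consequences of the halving adversary *)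

Section Harmonic.
Variable R : realType.
Local Open Scope ring_scope.

Definition harm (n : nat) : R := \sum_(i < n) i.+1%:R^-1.

Lemma harm0 : harm 0 = 0. Proof. exact: big_ord0. Qed.

Lemma harmS n : harm n.+1 = harm n + n.+1%:R^-1.
Proof. exact: big_ord_recr. Qed.

Lemma harm_le m n : (m <= n)%N -> harm m <= harm n.
Proof.
move/subnKC <-; elim: (n - m)%N => [|d IH]; first by rewrite addn0.
by rewrite addnS harmS (le_trans IH) // lerDl invr_ge0.
Qed.

Lemma harm_ge0 n : 0 <= harm n.
Proof. by rewrite -harm0 harm_le. Qed.

Lemma harm_add_le n d : harm (n + d) <= harm n + d%:R / n.+1%:R.
Proof.
elim: d => [|d IH]; first by rewrite addn0 mul0r addr0.
rewrite addnS harmS -(natr1 d) mulrDl addrA lerD // mul1r.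
by rewrite lef_pV2 ?posrE ?ltr0n // ler_nat ltnS leq_addr.
Qed.

Lemma harm_double n : harm (2 * n) <= harm n + 1.
Proof.
rewrite mul2n -addnn (le_trans (harm_add_le n n)) // lerD2l ler_pdivrMr ?ltr0n //.
by rewrite mul1r ler_nat.
Qed.

Lemma harm_growth g m t : (m <= g * 2 ^ t)%N -> harm m <= harm g + t%:R.
Proof.
elim: t m => [|t IH] m; first by rewrite muln1 addr0 => /harm_le.
rewrite expnS mulnCA => mg; apply: le_trans (harm_le mg) _.
apply: le_trans (harm_double _) _; rewrite -natr1 addrA lerD2r; exact: IH.
Qed.

(** With t the integer part of the binary logarithm of m / g, the number m is below g doubled t + 1
    times, and each doubling adds at most 1 to the harmonic number. *)
Lemma harm_le_of_halvings g m (y : R) : (0 < g)%N -> 0 <= y ->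
  (forall t, (g * 2 ^ t <= m)%N -> t%:R <= y) -> harm m <= harm g + y + 1.
Proof.
move=> g0 y0 H; case: (leqP g m) => [gm|/ltnW/harm_le]; last by lra.
pose t := trunc_log 2 (m %/ g).
have q0 : (0 < m %/ g)%N by rewrite divn_gt0.
have [//|lo hi] := andP (@trunc_log_bounds 2 (m %/ g) _ q0).
have ht : (g * 2 ^ t <= m)%N.
  by apply: leq_trans (leq_trunc_div m g); rewrite mulnC leq_mul2r lo orbT.
have : harm m <= harm g + t.+1%:R.
  by apply: harm_growth; rewrite mulnC ltnW // -ltn_divLR.
by have := H t ht; rewrite -natr1; lra.
Qed.

(* Expected number of faults caused by a hole that precedes [j] stale pages in
   the order of first requests, when the last [b] of them are not counted. *)
Definition pot b j : R := if (b <= j)%N then 1 + (harm j - harm b) else 0.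

Lemma pot_ge0 b j : 0 <= pot b j.
Proof. by rewrite /pot; case: ifP => // /harm_le; lra. Qed.

Lemma pot_le b i j : (i <= j)%N -> pot b i <= pot b j.
Proof.
move=> ij; rewrite [pot b i]/pot; case: leqP => bi; last exact: pot_ge0.
by rewrite /pot (leq_trans bi ij) lerD2l lerD2r harm_le.
Qed.

(** Gives the recurrence behind [pot]: for b <= m and m > 0, the value at m is 1, for the fault
    itself, plus the mean of the values at j < m, for the page then evicted, whose rank is
    uniform. *)
Lemma sum_pot b m : (b <= m)%N -> \sum_(j < m) pot b j = m%:R * (harm m - harm b).
Proof.
move/subnKC <-; elim: (m - b)%N => [|d IH].
  by rewrite addn0 subrr mulr0 big1 // => i _; rewrite /pot leqNgt ltn_ord.
rewrite addnS big_ord_recr IH /= /pot leq_addr harmS.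
set n := (b + d)%N; have n0 : n.+1%:R != 0 :> R by rewrite pnatr_eq0.
rewrite [LHS](_ : _ = n.+1%:R * (harm n - harm b) + 1); last by rewrite -natr1; ring.
by field.
Qed.

Lemma sum_pot_small b m : (m <= b)%N -> \sum_(j < m) pot b j = 0.
Proof.
by move=> mb; rewrite big1 // => i _; rewrite /pot leqNgt (leq_trans (ltn_ord i)).
Qed.

(** In the order of [key], the number of later elements takes each of the values 0, ..., [size L] -
    1 exactly once. *)
Lemma sum_by_rank (T : eqType) (L : seq T) (key : T -> nat) (f : nat -> R) :
  uniq L -> {in L &, injective key} ->
  \sum_(w <- L) f (count [pred w' | key w < key w']%N L) = \sum_(j < size L) f j.
Proof.
move=> uL inj.
pose le := [rel x y | (key x <= key y)%N].
have tot : total le by move=> x y; apply: leq_total.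
have pS : perm_eq (sort le L) L by rewrite perm_sort.
rewrite -(perm_big _ pS) -(perm_size pS) /=.
under eq_bigr do rewrite -(permP pS).
have uS : uniq (sort le L) by rewrite sort_uniq.
have injS : {in sort le L &, injective key} by move=> x y; rewrite !mem_sort; apply: inj.
have : sorted le (sort le L) by apply: sort_sorted.
elim: (sort le L) uS injS => [|x s IH] /=; first by rewrite big_nil big_ord0.
move=> /andP[xs us] injs; rewrite (path_sortedE (fun _ _ _ h1 h2 => leq_trans h1 h2)).
move=> /andP[/allP xle ss]; rewrite big_cons ltnn add0n big_ord_recr /= addrC; congr (_ + _).
  rewrite -IH //; last by move=> u v us' vs; apply: injs; rewrite inE ?us' ?vs orbT.
  apply: eq_big_seq => w ws; have := xle w ws; rewrite /= leqNgt => /negbTE ->.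
  by rewrite add0n.
congr (f _); apply/eqP; rewrite -all_count; apply/allP => w ws /=.
rewrite ltn_neqAle xle // andbT; apply: contraNneq xs => E.
by rewrite (injs x w _ _ E) // ?mem_head // inE ws orbT.
Qed.

End Harmonic.

(** * Harmonic bounds for leaves and stale pages from the halving adversary *)

Section LowerBoundUses.
Variables (R : realType) (T : eqType) (k : nat) (e : rel T) (r : R).
Hypothesis e_sym : symmetric e.
Hypothesis r_ge0 : (0 <= r)%R.
Local Open Scope ring_scope.

(** The conclusion of [halving_lower_bound] as a property of the number r alone; the analysis of RTO
    sees the competing algorithm only through it. *)
Definition halving_bounded := forall g a (K S : seq T) t, (0 < g)%N ->
  uniq (K ++ S) -> size (K ++ S) = (k + g)%N -> connected e K a ->
  (forall S1 x S2, S = S1 ++ x :: S2 -> has (adj e x) (K ++ S1)) ->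
  (forall S1 x S2, S = S1 ++ x :: S2 -> has (adj e x) (K ++ S2)) ->
  (g * 2 ^ t <= size S)%N -> t%:R <= 2 * r.

Hypothesis Hr : halving_bounded.

Lemma gedge_adj (p : seq T) u v : in_paths e p -> gedge p u v -> adj e u v.
Proof.
move=> pp; suff zip_adj x y : (x, y) \in zip p (behead p) -> adj e x y.
  by case/andP=> _ /orP[/zip_adj//|/zip_adj]; rewrite adj_sym.
case: p pp => //= z p; rewrite /in_paths /=; elim: p z => //= z' p IH z /andP[zz' pp].
by rewrite inE => /orP[/eqP[-> ->]//|]; apply: IH.
Qed.

Variables (p : seq T) (g0 : rel T).
Hypothesis p_path : in_paths e p.
Hypothesis g0_tree : spanning_tree p g0.

Let g0_adj u v : g0 u v -> adj e u v.
Proof. by case: g0_tree => _ ge _ _ /ge; apply: gedge_adj. Qed.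

(** The size of the set C of Subphase I. *)
Definition branching := count [pred v | count (g0 v) (undup p) != 2] (undup p).

(** Halving with g = 1. The searched pages are the childless ones other than the root [y], each
    attached to its parent; [K] consists of the remaining pages of the tree and the new page [x],
    which is attached to [y]. *)
Lemma harm_branching y x : size (undup p) = k -> y \in p -> x \notin p -> adj e y x ->
  harm R branching <= 2 * r + 4.
Proof.
move=> pk yp xp yx; have [d [pa [pa1 pa2]]] := rooted_tree g0_tree yp.
set nch := nchildren p y pa.
have pap v : v \in p -> v != y -> pa v \in p.
  by move=> vp vy; have [/(tree_mem g0_tree)/andP[]] := pa1 v vp vy.
have nch0 : (0 < count [pred v | nch v == 0] (undup p))%N.
  have := branching_le_leaves g0_tree yp pa1 pa2.
  have := sum_nchildren yp pa; rewrite -/nch => h1 _; rewrite lt0n; apply/negP => /eqP h2.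
  move: h1; rewrite ltnNge -sum1_size; case/negP; rewrite !(big_seq_cond xpredT).
  apply: leq_sum => v; rewrite andbT => vp; rewrite lt0n; apply/negP => v0.
  by move/eqP: h2; rewrite -leqn0 leqNgt -has_count => /hasPn /(_ v vp); rewrite /= v0.
pose L v := (nch v == 0%N) && (v != y).
pose S := [seq v <- undup p | L v]; pose K := x :: [seq v <- undup p | ~~ L v].
have sS : (count [pred v | nch v == 0%N] (undup p) <= (size S).+1)%N.
  rewrite size_filter -addn1; apply: leq_trans (_ : (count L (undup p) + count (pred1 y) (undup p) <= _)%N).
    rewrite -count_predUI; apply: leq_trans (leq_addr _ _); apply: sub_count => v /=.
    by rewrite /L => ->; case: (v == y).
  by rewrite leq_add2l count_uniq_mem ?undup_uniq // leq_b1.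
have SK v : v \in p -> v != y -> pa v \in K.
  move=> vp vy; rewrite inE mem_filter mem_undup pap // andbT; apply/orP; right.
  rewrite /L negb_and -lt0n; apply/orP; left; rewrite -has_count; apply/hasP; exists v.
    by rewrite mem_undup.
  by rewrite /= /child vy eqxx.
have yK : y \in K by rewrite inE mem_filter mem_undup yp /L eqxx andbF orbT.
have cK : connected e K y.
  split=> // v; rewrite inE => /orP[/eqP->|].
    by apply: reach_step yx _; [exact: mem_head|exact: reach_refl].
  rewrite mem_filter mem_undup => /andP[]; have [n] := ubnP (d v).
  elim: n v => // n IH v; rewrite ltnS => dv Lv vp.
  have [->|vy] := eqVneq v y; first exact: reach_refl.
  have [gv dpa] := pa1 v vp vy.
  have vK : v \in K by rewrite inE mem_filter Lv mem_undup vp orbT.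
  apply: reach_step vK _ (IH (pa v) (leq_trans dpa dv) _ _).
  - by rewrite adj_sym //; apply: g0_adj.
  - have := SK v vp vy; rewrite inE mem_filter => /orP[/eqP pax|/andP[]//].
    by move: xp; rewrite -pax pap.
  - exact: pap.
have attached v : v \in S -> has (adj e v) K.
  rewrite mem_filter mem_undup => /andP[/andP[_ vy] vp]; apply/hasP; exists (pa v); first exact: SK.
  by apply: g0_adj; case: (pa1 v vp vy).
have hS : harm R (size S) <= harm R 1 + 2 * r + 1.
  apply: harm_le_of_halvings; rewrite ?mulr_ge0 //.
  move=> t ht; apply: (Hr (g := 1) (a := y) (K := K) (S := S)) ht => //.
  - rewrite cat_uniq /= !filter_uniq ?undup_uniq // mem_filter mem_undup (negbTE xp) !andbF /= andbT.
    apply/hasPn => v; rewrite mem_filter => /andP[Lv vp]; rewrite inE mem_filter [L v]Lv orbF.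
    by apply: contraNneq xp => <-; rewrite -mem_undup.
  - by rewrite size_cat /= !size_filter addSn addnC count_predC pk addn1.
  - by move=> S1 v S2 E; rewrite has_cat attached // E mem_cat mem_head orbT.
  - by move=> S1 v S2 E; rewrite has_cat attached // E mem_cat mem_head orbT.
(* There are at most [size S] + 1 childless pages, counting the root. This extra page and the factor
   2 of [branching_le_leaves] each add at most 1 to the bound 2 r + 2 for [S]. *)
have hb : harm R branching <= harm R (2 * (size S).+1).
  by apply: harm_le; apply: leq_trans (branching_le_leaves g0_tree yp pa1 pa2) _; rewrite leq_mul2l.
have h1 : (size S).+1%:R^-1 <= 1 :> R by rewrite invf_le1 ?ltr0n // ler1n.
have := harm_double R (size S).+1; rewrite (harmS _ (size S)).
have e1 : harm R 1 = 1 by rewrite harmS harm0 add0r invr1.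
rewrite e1 in hS => h2; apply: le_trans hb (le_trans h2 _).
move: h1; set b := _^-1; lra.
Qed.

(** There are fewer children than pages, so some page is childless, and its degree is at most 1. *)
Lemma branching_exists : p != [::] -> exists2 v, v \in p & count (g0 v) (undup p) != 2.
Proof.
case: (p) g0_tree => // y q tr _; have yp : y \in y :: q by exact: mem_head.
have [d [pa [pa1 pa2]]] := rooted_tree tr yp.
have := sum_nchildren yp pa.
case: (boolP (has [pred v | nchildren (y :: q) y pa v == 0%N] (y :: q))).
  move=> /hasP[v vp v0] _; exists v => //; rewrite (degE tr yp pa1 pa2) //.
  by move/eqP: v0 => ->; case: (v != y).
move/hasPn => noleaf; rewrite ltnNge -sum1_size; case/negP; rewrite !(big_seq_cond xpredT).
by apply: leq_sum => v; rewrite andbT mem_undup lt0n => /noleaf.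
Qed.

(* Ordered by depth, the pages of S can be searched from both ends: the parent of
   each lies in K or comes earlier, and its child lies in K or comes later. *)
Lemma harm_stale (K S : seq T) a G : connected e K a -> uniq (K ++ S) -> {subset S <= p} ->
  (k < size (K ++ S) <= k + G)%N ->
  {in S, forall v, count (g0 v) (undup p) = 2} ->
  (forall u v, v \in S -> g0 u v -> u \in K ++ S) ->
  harm R (size S) <= harm R G + 2 * r + 1.
Proof.
move=> cK uKS Sp /andP[kKS KSk] degS nbr.
case: (posnP (size S)) => [->|S0].
  by rewrite harm0 !addr_ge0 ?harm_ge0 // mulr_ge0.
(* The root is chosen of degree other than 2, hence outside [S]; so each page of [S] has a parent
   and exactly one child. *)
have [|y yp dy] := branching_exists.
  by case: (S) S0 Sp => // v S' _ /(_ v (mem_head _ _)); case: (p).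
have yS : y \notin S by apply: contra dy => /degS ->.
have [d [pa [pa1 pa2]]] := rooted_tree g0_tree yp.
have gs : symmetric g0 by case: g0_tree.
pose le := [rel u v | (d u <= d v)%N].
pose S' := sort le S.
have le_tr : transitive le by move=> u v w; apply: leq_trans.
have sS' : sorted le S' by apply: sort_sorted => u v; apply: leq_total.
have KS' : K ++ S =i K ++ S' by move=> v; rewrite !mem_cat mem_sort.
(* The adversary needs the exact excess over k; passing from it to its upper bound [G] only weakens
   the estimate. *)
pose g := (size (K ++ S) - k)%N.
have gG : (g <= G)%N by rewrite /g; lia.
have g_gt0 : (0 < g)%N by rewrite subn_gt0.
apply: le_trans (_ : harm R g + 2 * r + 1 <= _); last by rewrite !lerD2r harm_le.
apply: harm_le_of_halvings; rewrite ?mulr_ge0 //.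
have split_le S1 v S2 : S' = S1 ++ v :: S2 ->
    {in S1, forall u, d u <= d v}%N /\ {in S2, forall u, d v <= d u}%N.
  move=> E; move: sS'; rewrite E sorted_pairwise // pairwise_cat /=.
  case/and3P=> /allrelP h1 _ /andP[/allP h2 _]; split=> u; last exact: h2.
  by move/h1; apply; apply: mem_head.
move=> t ht; apply: (Hr (g := g) (a := a) (K := K) (S := S') (t := t)) => //.
- by rewrite (perm_uniq (s2 := K ++ S)) // perm_cat2l perm_sort.
- by rewrite size_cat size_sort -size_cat subnKC // ltnW.
- move=> S1 v S2 E; have [_ h2] := split_le _ _ _ E.
  have vS : v \in S by rewrite -(mem_sort le) -/S' E mem_cat mem_head orbT.
  have vy : v != y by apply: contraNneq yS => <-.
  have [gv dpa] := pa1 v (Sp v vS) vy.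
  apply/hasP; exists (pa v); last exact: g0_adj.
  have : pa v \in K ++ S by apply: (nbr _ v) => //; rewrite gs.
  rewrite KS' E !mem_cat inE => /or4P[->//|->|/eqP pv|/h2]; rewrite ?orbT //.
    by rewrite pv ltnn in dpa.
  by rewrite leqNgt dpa.
- move=> S1 v S2 E; have [h1 _] := split_le _ _ _ E.
  have vS : v \in S by rewrite -(mem_sort le) -/S' E mem_cat mem_head orbT.
  have vy : v != y by apply: contraNneq yS => <-.
  have : (0 < nchildren p y pa v)%N.
    by have := degS v vS; rewrite (degE g0_tree yp pa1 pa2) ?Sp // vy; lia.
  rewrite -has_count => /hasP[c cp /andP[cy /eqP pc]].
  rewrite mem_undup in cp; have [gc dc] := pa1 c cp cy; rewrite pc in gc dc.
  apply/hasP; exists c; last by apply: g0_adj; rewrite gs.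
  have : c \in K ++ S by apply: (nbr _ v).
  rewrite KS' E !mem_cat inE => /or4P[->//|/h1|/eqP cv|->]; rewrite ?orbT //.
    by rewrite leqNgt dc.
  by rewrite cv ltnn in dc.
- by rewrite size_sort.
Qed.

End LowerBoundUses.

(** * Finitely supported laws and the potential of the holes *)

Section Laws.
Variable R : realType.
Local Open Scope ring_scope.
Implicit Types A B : Type.

Fixpoint supported A (Q : A -> Prop) (d : dist R A) : Prop :=
  if d is p :: d' then [/\ 0 <= p.1, Q p.2 & supported Q d'] else True.

Definition law A (d : dist R A) (Q : A -> Prop) := \sum_(p <- d) p.1 = 1 /\ supported Q d.

Lemma supported_cat A (Q : A -> Prop) d1 d2 :
  supported Q d1 -> supported Q d2 -> supported Q (d1 ++ d2).
Proof. by elim: d1 => //= p d1 IH [p0 Qp /IH h] /h. Qed.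

Lemma dexp_le A (Q : A -> Prop) (d : dist R A) f h : supported Q d ->
  (forall a, Q a -> f a <= h a) -> dexp d f <= dexp d h.
Proof.
move=> + fh; rewrite /dexp; elim: d => [|p d IH] /=; first by rewrite !big_nil.
by case=> p0 /fh fhp /IH; rewrite !big_cons; apply: lerD; apply: ler_wpM2l.
Qed.

Lemma dexp_cst A (Q : A -> Prop) (d : dist R A) c : law d Q -> dexp d (fun=> c) = c.
Proof. by case=> m _; rewrite /dexp -mulr_suml m mul1r. Qed.

Lemma dexp_le_cst A (Q : A -> Prop) (d : dist R A) f c : law d Q ->
  (forall a, Q a -> f a <= c) -> dexp d f <= c.
Proof. by move=> dQ /(dexp_le dQ.2); rewrite (dexp_cst _ dQ). Qed.

Lemma dexp_cat A (d1 d2 : dist R A) f : dexp (d1 ++ d2) f = dexp d1 f + dexp d2 f.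
Proof. exact: big_cat. Qed.

Lemma dexp_scale A (d : dist R A) f c :
  dexp [seq (c * q.1, q.2) | q <- d] f = c * dexp d f.
Proof. by rewrite /dexp big_map mulr_sumr; apply: eq_bigr => q _; rewrite mulrA. Qed.

Lemma dexp_dret A (a : A) f : dexp (dret R a) f = f a.
Proof. by rewrite /dexp big_seq1 mul1r. Qed.

Lemma dexp_dbind A B (d : dist R A) (F : A -> dist R B) f :
  dexp (dbind d F) f = dexp d (fun a => dexp (F a) f).
Proof.
rewrite /dbind; elim: d => [|p d IH] /=; first by rewrite /dexp !big_nil.
by rewrite dexp_cat dexp_scale IH [in RHS]/dexp big_cons.
Qed.

Lemma law_dret A (a : A) (Q : A -> Prop) : Q a -> law (dret R a) Q.
Proof. by split; rewrite ?big_seq1 //= ler01. Qed.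

Lemma law_dbind A B (d : dist R A) (F : A -> dist R B) Q Q' : law d Q ->
  (forall a, Q a -> law (F a) Q') -> law (dbind d F) Q'.
Proof.
case=> d1 dQ FQ; split.
  have mass C (d' : dist R C) : \sum_(p <- d') p.1 = dexp d' (fun=> 1).
    by apply: eq_bigr => p _; rewrite mulr1.
  rewrite mass dexp_dbind -[RHS](dexp_cst 1 (conj d1 dQ)); apply/eqP; rewrite eq_le; apply/andP.
  by split; apply: dexp_le dQ _ => a /FQ FaQ; rewrite (dexp_cst _ FaQ).
rewrite /dbind; elim: d dQ {d1} => //= p d IH [p0 Qp /IH h].
apply: supported_cat => //; have [_] := FQ _ Qp.
elim: (F p.2) => //= q d' IH' [q0 Qq /IH' h']; split=> //.
exact: mulr_ge0.
Qed.

Lemma law_sub A (d : dist R A) (Q Q' : A -> Prop) : (forall a, Q a -> Q' a) ->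
  law d Q -> law d Q'.
Proof.
move=> QQ' [d1 dQ]; split=> //; elim: d dQ {d1} => //= p d IH [p0 /QQ' Qp /IH h]; by [].
Qed.

Lemma law_uniform (T : eqType) B (l : seq T) (F : T -> B) Q : l != [::] ->
  (forall x, x \in l -> Q (F x)) -> law (uniform R [seq F x | x <- l]) Q.
Proof.
move=> l0 lQ; rewrite /uniform size_map; split.
  rewrite !big_map /= big_const_seq count_predT iter_addr_0 -[_ *+ _]mulr_natr mulVf //.
  by rewrite pnatr_eq0 size_eq0.
move: (size l) => n; elim: l lQ {l0} => //= x l IH lQ; split.
- by rewrite invr_ge0.
- by apply: lQ; rewrite mem_head.
- by apply: IH => y yl; apply: lQ; rewrite inE yl orbT.
Qed.

Lemma dexp_uniform (T : Type) B (l : seq T) (F : T -> B) f :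
  dexp (uniform R [seq F x | x <- l]) f = (\sum_(x <- l) f (F x)) / (size l)%:R.
Proof.
rewrite /dexp /uniform size_map !big_map mulr_suml.
by apply: eq_bigr => x _; rewrite mulrC.
Qed.

End Laws.

(** * The potential of the holes under random eviction *)

Section HolePotential.
Variables (R : realType) (T : eqType) (p : seq T).
Local Open Scope ring_scope.
Implicit Types (A H : pred T) (s : seq T) (w h r : T).

(* Pages of [p] ordered by their next request in [s]; those never requested come last. *)
Definition next_use s w := index w (s ++ p).

Definition later A s h := count [pred w | A w && (next_use s h < next_use s w)%N] (undup p).

(** [A] stands for the pages among which random evictions choose and [H] for the holes, each of
    which starts a chain of faults. *)
Definition pots b A H s : R := \sum_(h <- undup p | H h) pot R b (later A s h).

Lemma next_use_inj s : {in p &, injective (next_use s)}.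
Proof.
move=> x y xp yp E; rewrite -(nth_index x (_ : x \in s ++ p)) ?mem_cat ?xp ?orbT //.
by rewrite -/(next_use s x) E nth_index // mem_cat yp orbT.
Qed.

Lemma next_use_cons r s w : w != r -> next_use (r :: s) w = (next_use s w).+1.
Proof. by move=> wr; rewrite /next_use /= eq_sym (negbTE wr). Qed.

Lemma next_use_head r s : next_use (r :: s) r = 0%N.
Proof. by rewrite /next_use /= eqxx. Qed.

Let sum_rem H r (F : T -> R) : r \in p -> H r ->
  \sum_(h <- undup p | H h) F h = F r + \sum_(h <- undup p | H h && (h != r)) F h.
Proof.
move=> rp Hr; rewrite -big_filter (bigD1_seq r) ?filter_uniq ?undup_uniq ?mem_filter ?Hr ?mem_undup //=.
by rewrite big_filter_cond.
Qed.

(** The requested page comes first in the order of next uses, so all of [A] except itself lies after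
    it; the order of the other pages is unchanged. *)
Lemma pots_cons b A H r s : (H r -> r \in p /\ ~~ A r) ->
  pots b A H (r :: s) = pots b [pred w | A w && (w != r)] [pred h | H h && (h != r)] s
    + (if H r then pot R b (count [pred w | A w && (w != r)] (undup p)) else 0).
Proof.
move=> Hr; have lat h : h != r ->
    later A (r :: s) h = later [pred w | A w && (w != r)] s h.
  move=> hr; apply: eq_count => w /=; rewrite next_use_cons //.
  have [->|wr] := eqVneq w r; first by rewrite next_use_head !andbF.
  by rewrite next_use_cons // ltnS andbT.
have rest : \sum_(h <- undup p | H h && (h != r)) pot R b (later A (r :: s) h)
    = pots b [pred w | A w && (w != r)] [pred h | H h && (h != r)] s.
  by apply: eq_bigr => h /andP[_ hr]; rewrite lat.
case: ifP => [Hr'|/negbT Hr'].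
  have [rp nAr] := Hr Hr'.
  rewrite [LHS](@sum_rem _ r) // rest addrC; congr (_ + pot _ _ _).
  apply: eq_count => w /=; rewrite next_use_head.
  have [->|wr] := eqVneq w r; first by rewrite next_use_head ltnn !andbF.
  by rewrite next_use_cons // andbT.
rewrite addr0 -rest; apply: eq_bigl => h.
by have [->|_] := eqVneq h r; rewrite ?andbT // (negbTE Hr') .
Qed.

(** Taking [w] out of [A] raises no term of an old hole, and over all [w] the rank of the new hole
    takes each value once, by [sum_by_rank]. *)
Lemma pots_evict b A H s : (forall w, A w -> ~~ H w) ->
  \sum_(w <- [seq w <- undup p | A w])
     pots b [pred x | A x && (x != w)] [pred x | H x || (x == w)] s
  <= (count A (undup p))%:R * pots b A H s + \sum_(j < count A (undup p)) pot R b j.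
Proof.
move=> AH; set m := count A _; set L := [seq w <- undup p | A w].
have mL : m = size L by rewrite size_filter.
have -> : \sum_(j < m) pot R b j = \sum_(w <- L) pot R b (later A s w).
  rewrite mL -(@sum_by_rank R _ L (next_use s)) ?filter_uniq ?undup_uniq //; last first.
    move=> x y; rewrite !mem_filter !mem_undup => /andP[_ xp] /andP[_ yp]; exact: next_use_inj.
  by apply: eq_bigr => w _; congr (pot _ _ _); rewrite count_filter; apply: eq_count => x /=; rewrite andbC.
have -> : m%:R * pots b A H s = \sum_(w <- L) pots b A H s.
  by rewrite mL big_const_seq count_predT iter_addr_0 mulr_natl.
rewrite -big_split /= !(big_seq_cond xpredT); apply: ler_sum => w.
rewrite andbT mem_filter mem_undup => /andP[Aw wp].
have mono h : pot R b (later [pred x | A x && (x != w)] s h) <= pot R b (later A s h).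
  by apply: pot_le; apply: sub_count => x /= /andP[/andP[-> _] ->].
rewrite [leLHS](@sum_rem _ w) //= ?eqxx ?orbT // [leRHS]addrC lerD //.
rewrite [leRHS](eq_bigl [pred x | (H x || (x == w)) && (x != w)]); first exact: ler_sum.
move=> x /=; have [->|_] := eqVneq x w; last by rewrite orbF andbT.
by rewrite (negbTE (AH _ Aw)).
Qed.

Lemma pots_le b A H s : pots b A H s <= (count H (undup p))%:R * pot R b (count A (undup p)).
Proof.
rewrite mulr_natl -iter_addr_0 -big_const_seq; apply: ler_sum => h _.
by apply: pot_le; apply: sub_count => w /= /andP[].
Qed.

Lemma eq_pots b A A' H H' s : {in p, A =1 A'} -> {in p, H =1 H'} ->
  pots b A H s = pots b A' H' s.
Proof.
move=> eA eH; rewrite /pots big_seq_cond [RHS]big_seq_cond.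
rewrite (eq_bigl (fun h => (h \in undup p) && H' h)); last first.
  by move=> h; rewrite mem_undup; apply: andb_id2l => /eH.
apply: eq_bigr => h _; congr (pot _ _ _); apply: eq_in_count => w.
by rewrite mem_undup => /eA /= ->.
Qed.

End HolePotential.

(** * State invariants *)

Lemma count_neq (T : eqType) (a : pred T) r s : uniq s ->
  count [pred x | a x && (x != r)] s + (a r && (r \in s)) = count a s.
Proof.
elim: s => [|y s IH] /=; first by rewrite andbF.
case/andP=> ys us; rewrite -IH // inE (eq_sym r y).
have [yr|yr] := eqVneq y r; last by rewrite andbT addnA.
by subst y; rewrite (negbTE ys) !andbF !andbT add0n addn0 addnC.
Qed.

Section StateUpdates.
Variable T : eqType.
Implicit Types (st : state T) (x r : T) (o : T * subphase T).

Lemma stale_mark st r x : stale (mark st r) x = stale st x && (x != r).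
Proof.
by case: st => *; rewrite /stale /= mem_rcons inE negb_or; case: (x == r); rewrite ?andbF ?andbT.
Qed.

Lemma hole_mark st r x : hole (mark st r) x = hole st x && (x != r).
Proof.
by case: st => *; rewrite /hole /= mem_rcons inE negb_or; case: (x == r); rewrite ?andbF ?andbT.
Qed.

Lemma stale_replace st r o x : stale (replace st r o) x = stale st x && (x != o.1).
Proof.
by case: st => *; rewrite /stale /= inE negb_or; case: (x == o.1); rewrite ?andbF ?andbT.
Qed.

Lemma hole_replace st r o x : stale st o.1 ->
  hole (replace st r o) x = hole st x || (x == o.1).
Proof.
case: st => h c p q ed g sp n; rewrite /hole /stale /= inE => /and3P[op oq oed].
by case: (eqVneq x o.1) => [->|_]; rewrite ?orbF //= op oq orbT.
Qed.

Lemma stale_notin_hole st x : stale st x -> ~~ hole st x.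
Proof. by case/and3P => _ _ xe; rewrite /hole (negbTE xe) andbF. Qed.

Lemma prv_mark st r : prv (mark st r) = prv st. Proof. by case: st. Qed.
Lemma tree0_mark st r : tree0 (mark st r) = tree0 st. Proof. by case: st. Qed.
Lemma evd_mark st r : evd (mark st r) = evd st. Proof. by case: st. Qed.
Lemma sub_mark st r : sub (mark st r) = sub st. Proof. by case: st. Qed.
Lemma cache_mark st r : cache (mark st r) = cache st. Proof. by case: st. Qed.
Lemma cur_mark st r : cur (mark st r) = rcons (cur st) r. Proof. by case: st. Qed.
Lemma nfaults_mark st r : nfaults (mark st r) = nfaults st. Proof. by case: st. Qed.
Lemma inC_mark st r x : inC (mark st r) x = inC st x. Proof. by case: st. Qed.
Definition markE := (prv_mark, tree0_mark, evd_mark, sub_mark, cache_mark, cur_mark, nfaults_mark, inC_mark).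

Lemma prv_replace st r o : prv (replace st r o) = prv st. Proof. by case: st. Qed.
Lemma tree0_replace st r o : tree0 (replace st r o) = tree0 st. Proof. by case: st. Qed.
Lemma evd_replace st r o : evd (replace st r o) = o.1 :: evd st. Proof. by case: st. Qed.
Lemma sub_replace st r o : sub (replace st r o) = o.2. Proof. by case: st. Qed.
Lemma cache_replace st r o : cache (replace st r o) = r :: rem o.1 (cache st). Proof. by case: st. Qed.
Lemma cur_replace st r o : cur (replace st r o) = cur st. Proof. by case: st. Qed.
Lemma nfaults_replace st r o : nfaults (replace st r o) = (nfaults st).+1. Proof. by case: st. Qed.
Lemma inC_replace st r o x : inC (replace st r o) x = inC st x. Proof. by case: st. Qed.
Definition replaceE := (prv_replace, tree0_replace, evd_replace, sub_replace, cache_replace,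
  cur_replace, nfaults_replace, inC_replace).

End StateUpdates.

(** * Invariants of cache, marks and holes within a phase *)

Section PhaseInvariants.
Variables (T : eqType) (k : nat) (ch : choices T) (P p : seq T) (g0 : rel T).
Hypothesis pk : size (undup p) <= k.
Implicit Types (st : state T) (x r : T) (s t : seq T) (o : T * subphase T).

Notation U := (undup P).
Notation G := (new_pages P p).

Definition fresh t s := size (undup [seq x <- s | (x \notin P) && (x \notin t)]).

Lemma fresh_cons t r s : fresh t (r :: s) = ((r \notin P) && (r \notin t)) + fresh (rcons t r) s.
Proof.
rewrite /fresh [seq.filter _ (r :: s)]/=; case: ifP => rn.
  rewrite add1n -[RHS]/(size (r :: undup [seq x <- s | (x \notin P) && (x \notin rcons t r)])).
  apply/perm_size/uniq_perm; first exact: undup_uniq.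
    by rewrite /= mem_undup mem_filter mem_rcons mem_head andbF undup_uniq.
  move=> x; rewrite inE !mem_undup inE !mem_filter mem_rcons inE negb_or.
  by case: (x == r).
congr (size (undup _)); apply: eq_in_filter => x xs.
rewrite mem_rcons inE negb_or; have [->|//] := eqVneq x r.
by rewrite rn andbF.
Qed.

(** Holds between two requests of a phase that starts with a full cache; [s] is what remains of the
    phase. In [core_fresh], a request to a new page opens one hole, while a fault on a hole closes
    one and opens one; hence holes and new pages still to come number G together. *)
Record core st s : Prop := Core {
  core_prv : prv st = P;
  core_tree : tree0 st = g0;
  core_cur : cur st ++ s = p;
  core_uniq : uniq (cache st);
  core_size : size (cache st) = k;
  core_mem : forall x, (x \in cache st) = (x \in cur st) || stale st x;
  core_fresh : count (hole st) U + fresh (cur st) s = G }.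

(* The state after a fault on [r] is marked and before the eviction is decided. *)
Record faulted st r s : Prop := Faulted {
  faulted_prv : prv st = P;
  faulted_tree : tree0 st = g0;
  faulted_cur : cur st ++ s = p;
  faulted_in_cur : r \in cur st;
  faulted_uniq : uniq (cache st);
  faulted_size : size (cache st) = k;
  faulted_notin : r \notin cache st;
  faulted_mem : forall x, (x \in cache st) = ((x \in cur st) && (x != r)) || stale st x;
  faulted_fresh : (count (hole st) U + fresh (cur st) s).+1 = G }.

Lemma core_hit st r s : core st (r :: s) -> r \in cache st -> core (mark st r) s.
Proof.
case=> h1 h2 h3 h4 h5 h6 h7 rc; split; rewrite ?markE //.
- by rewrite cat_rcons.
- move=> x; rewrite h6 stale_mark mem_rcons inE.
  have [->|_] := eqVneq x r; last by rewrite andbT.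
  by rewrite -h6.
- rewrite -h7 fresh_cons; move: rc; rewrite h6 => rc.
  have -> : (r \notin P) && (r \notin cur st) = false.
    by case/orP: rc => [->|/and3P[]]; rewrite ?andbF // h1 => ->.
  rewrite add0n; congr (_ + _); apply: eq_count => x; rewrite hole_mark.
  have [->|] := eqVneq x r; last by rewrite andbT.
  case/orP: rc => [rq|/stale_notin_hole/negbTE ->//].
  by rewrite /hole rq !andbF.
Qed.

(** A page of [P] outside the cache is neither marked nor stale, so it was evicted in this phase: a
    miss requests a hole or a new page. *)
Lemma core_miss st r s : core st (r :: s) -> r \notin cache st ->
  faulted (mark st r) r s /\ hole st r = (r \in P) /\ r \notin cur st.
Proof.
case=> h1 h2 h3 h4 h5 h6 h7 rc.
have := rc; rewrite h6 negb_or => /andP[rq rs].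
have hr : hole st r = (r \in P).
  by move: rs; rewrite /stale /hole h1 rq /= negb_and negbK; case: (r \in P) => //= ->.
split; last by []; split; rewrite ?markE //.
- by rewrite cat_rcons.
- by rewrite mem_rcons mem_head.
- move=> x; rewrite h6 stale_mark mem_rcons inE; have [->|//] := eqVneq x r.
    by rewrite andbF /= andbF (negbTE rq) (negbTE rs).
  by rewrite /= !andbT.
- rewrite -h7 fresh_cons rq andbT addnA -addSn; congr (_ + _).
  rewrite (eq_count (a2 := [pred x | hole st x && (x != r)])); last by move=> x; rewrite hole_mark.
  rewrite -(count_neq (hole st) r (undup_uniq P)) mem_undup hr andbb.
  by case: (r \in P); rewrite ?addn0 ?addn1.
Qed.

Lemma core_evict st r s o : faulted st r s -> stale st o.1 -> core (replace st r o) s.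
Proof.
case=> h1 h2 h3 hr h4 h5 rc h6 h7 so.
have oc : o.1 \in cache st by rewrite h6 so orbT.
have /and3P[oP oq _] := so; rewrite h1 in oP.
split; rewrite ?replaceE //.
- by rewrite /= rem_uniq // andbT; apply: contra rc; apply: mem_rem.
- by rewrite /= size_rem // prednK // -has_predT; apply/hasP; exists o.1.
- move=> x; rewrite inE mem_rem_uniq // inE h6 stale_replace.
  have [->|xr] := eqVneq x r; first by rewrite hr.
  rewrite andbT; have [->|xo] /= := eqVneq x o.1; last by rewrite andbT.
  by rewrite (negbTE oq) andbF.
- rewrite -h7 -addSn; congr (_ + _).
  rewrite -(count_neq (hole (replace st r o)) o.1 (undup_uniq P)) mem_undup oP andbT.
  rewrite hole_replace // eqxx orbT addn1; congr _.+1; apply: eq_count => x /=.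
  rewrite hole_replace //; have [->|_] := eqVneq x o.1; last by rewrite orbF andbT.
  by rewrite andbF (negbTE (stale_notin_hole so)).
Qed.

Lemma start_phase_id st r s : core st (r :: s) -> start_phase k ch st r = st.
Proof.
case: st => h c q' q ed g sp n [/= _ _ qp _ _ _ _]; rewrite /start_phase.
case: ifP => // /andP[rq kq]; suff : (size (undup (r :: q)) <= k)%N.
  by rewrite /= (negbTE rq) /= ltnNge kq.
apply: leq_trans (size_undup_sub _) pk => x.
by rewrite -qp mem_cat !inE => /orP[->|->]; rewrite ?orbT.
Qed.

Lemma faulted_unmarked st r s : faulted st r s ->
  perm_eq [seq x <- cache st | ~~ marked st x] [seq x <- U | stale st x].
Proof.
case=> h1 h2 h3 hr h4 h5 rc h6 h7; apply: uniq_perm; rewrite ?filter_uniq ?undup_uniq //.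
move=> x; rewrite !mem_filter mem_undup h6 /marked.
by rewrite /stale h1; case: (x \in P); case: (x \in cur st); rewrite ?andbF ?andbT.
Qed.

(** The unmarked pages of the cache are the stale ones, and the requested page is marked but not yet
    in the cache; hence k + 1. *)
Lemma faulted_sizes st r s : faulted st r s ->
  size (undup (cur st)) + count (stale st) U = k.+1.
Proof.
move=> F; have := faulted_unmarked F; case: F => h1 h2 h3 hr h4 h5 rc h6 h7 /perm_size.
rewrite !size_filter => <-.
have -> : size (undup (cur st)) = (count (marked st) (cache st)).+1.
  rewrite -[LHS]count_predT -(count_neq predT r (undup_uniq _)) mem_undup hr addn1; congr _.+1.
  rewrite -!size_filter; apply/perm_size/uniq_perm; rewrite ?filter_uniq ?undup_uniq //.
  move=> x; rewrite !mem_filter mem_undup h6 /marked /stale /=.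
  by case: (x \in cur st); case: (x != r); rewrite /= ?andbF ?orbF.
by rewrite addSn count_predC h5.
Qed.

Lemma faulted_stale_gt0 st r s : faulted st r s -> 0 < count (stale st) U.
Proof.
move=> F; have := faulted_sizes F; case: F => _ _ qp _ _ _ _ _ _.
have : size (undup (cur st)) <= k.
  by apply: leq_trans (size_undup_sub _) pk => x; rewrite -qp mem_cat => ->.
lia.
Qed.

End PhaseInvariants.

(** * The table of Subphase II *)

Section Balance.
Variables (R : realType) (T : eqType) (G : nat).
Implicit Types (b : pred T) (tab : seq (T * seq T)).
Local Open Scope ring_scope.

Definition nkeys b tab := count (fun vA => b vA.1) tab.
Definition table_size tab := size (flatten [seq vA.2 | vA <- tab]).

(* [b] contains the keys of the alive sets.  The smallest of J alive sets has at most
   G/J elements, so the i-th last set to die has at most G/i + 1. *)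
Definition balanced b tab : Prop :=
  (forall vA, vA \in tab -> b vA.1 -> (size vA.2)%:R <= G%:R / (nkeys b tab)%:R + 1 :> R) /\
  \sum_(vA <- tab | ~~ b vA.1) (size vA.2)%:R <=
    G%:R * (harm R (size tab) - harm R (nkeys b tab)) + ((size tab)%:R - (nkeys b tab)%:R).

Lemma harm_gap i d : d%:R / (i + d)%:R <= harm R (i + d) - harm R i.
Proof.
elim: d => [|d IH]; first by rewrite addn0 mul0r subrr.
rewrite addnS harmS -(natr1 d) mulrDl mul1r addrAC lerD2r.
apply: le_trans IH; have [->|d0] := posnP d; first by rewrite !mul0r.
rewrite ler_wpM2l // lef_pV2 ?posrE ?ltr0n ?ler_nat //; lia.
Qed.

Lemma sum_table_size tab : \sum_(vA <- tab) (size vA.2)%:R = (table_size tab)%:R :> R.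
Proof.
rewrite /table_size; elim: tab => [|vA tab IH] /=; first by rewrite big_nil.
by rewrite big_cons IH size_cat natrD.
Qed.

(** If the number of keys in the predicate falls from J to J', each set that dies has at most G / J
    + 1 elements, and (J - J') / J is at most the drop of the harmonic number. *)
Lemma balanced_shrink b b' tab : subpred b' b -> balanced b tab -> balanced b' tab.
Proof.
move=> b'b [b1 b2]; set J := nkeys b tab; set J' := nkeys b' tab.
have JJ : (J' <= J)%N by apply: sub_count => vA; apply: b'b.
split=> [vA vAt b'v|].
  have J'0 : (0 < J')%N by rewrite -has_count; apply/hasP; exists vA.
  apply: le_trans (b1 _ vAt (b'b _ b'v)) _; rewrite lerD2r ler_wpM2l //.
  by rewrite lef_pV2 ?posrE ?ltr0n ?ler_nat // (leq_trans J'0).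
rewrite (bigID (fun vA => b vA.1)) /= addrC.
rewrite (eq_bigl (fun vA => ~~ b vA.1)); last first.
  by move=> vA /=; case: (boolP (b vA.1)) => // nb; rewrite ?andbF ?andbT //; apply: contra nb => /b'b.
have dying : \sum_(vA <- tab | ~~ b' vA.1 && b vA.1) (size vA.2)%:R
    <= (J - J')%:R * (G%:R / J%:R + 1) :> R.
  have <- : count (fun vA => ~~ b' vA.1 && b vA.1) tab = (J - J')%N.
    suff E : (count (fun vA => ~~ b' vA.1 && b vA.1) tab + J' = J)%N by rewrite -E addnK.
    rewrite /J /J' /nkeys !count_sum -big_split /=; apply: eq_bigr => vA _.
    by have := b'b vA.1; case: (b' _) => [/(_ isT) ->|_] //=; rewrite addn0.
  rewrite mulr_natl -iter_addr_0 -big_const_seq big_seq_cond [leRHS]big_seq_cond.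
  by apply: ler_sum => vA /and3P[vAt _]; apply: b1.
apply: le_trans (lerD b2 dying) _.
have := harm_gap J' (J - J'); rewrite subnKC // => gap.
have : G%:R * ((J - J')%:R / J%:R) <= G%:R * (harm R J - harm R J') by rewrite ler_wpM2l.
rewrite (natrB _ JJ); set x := _ / J%:R => ?.
have -> : (J%:R - J'%:R) * (G%:R / J%:R + 1) = G%:R * ((J%:R - J'%:R) / J%:R) + (J%:R - J'%:R) :> R.
  by rewrite mulrDr mulr1 mulrCA.
rewrite -/J -/J' -/x; nra.
Qed.

(** Declare all sets dead. *)
Lemma balanced_total b tab : balanced b tab ->
  (table_size tab)%:R <= G%:R * harm R (size tab) + (size tab)%:R :> R.
Proof.
have sub0 : subpred pred0 b by [].
move/(balanced_shrink sub0) => [_]; rewrite /nkeys (count_pred0 tab) harm0 !subr0.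
by rewrite (eq_bigl predT) // sum_table_size.
Qed.

End Balance.

Section Grow.
Variable T : eqType.
Implicit Types (v w x : T) (A : seq T) (tab : seq (T * seq T)).

Lemma grow_keys vw tab : [seq vA.1 | vA <- grow vw tab] = [seq vA.1 | vA <- tab].
Proof. by rewrite /grow -map_comp; apply: eq_map => vA /=; case: ifP. Qed.

Lemma grow_notin v w tab : v \notin [seq vA.1 | vA <- tab] -> grow (v, w) tab = tab.
Proof.
rewrite /grow; elim: tab => //= vA tab IH; rewrite inE negb_or eq_sym => /andP[/negbTE -> /IH ->].
by [].
Qed.

Lemma grow_flatten v w tab : uniq [seq vA.1 | vA <- tab] -> v \in [seq vA.1 | vA <- tab] ->
  perm_eq (flatten [seq vA.2 | vA <- grow (v, w) tab]) (w :: flatten [seq vA.2 | vA <- tab]).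
Proof.
elim: tab => //= -[u A] tab IH /= /andP[ut utab]; rewrite inE.
have [<- _|vu /= vt] := eqVneq u v; last first.
  apply: perm_trans (_ : perm_eq (A ++ w :: flatten [seq vA.2 | vA <- tab]) _).
    by rewrite perm_cat2l; apply: IH.
  by rewrite (perm_catCA A [:: w]).
by rewrite -/(grow (u, w) tab) grow_notin.
Qed.

Lemma mem_grow v w tab vA : vA \in grow (v, w) tab -> uniq [seq vA.1 | vA <- tab] ->
  (vA.1 != v /\ vA \in tab) \/ (exists2 A, (v, A) \in tab & vA = (v, w :: A)).
Proof.
move=> /mapP[[u A] ut ->] /= _; case: ifP => [/eqP uv|uv]; last by left; rewrite /= uv.
by right; exists A; rewrite -?uv.
Qed.

Variable g0 : rel T.

(** Newest page first: every page but the oldest is adjacent to one added before it. *)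
Fixpoint treelike A : bool :=
  if A is w :: A' then (nilp A' || has (fun a => g0 a w) A') && treelike A' else true.

End Grow.

Lemma uniq_keys_inj (T U : eqType) (tab : seq (T * U)) : uniq [seq vA.1 | vA <- tab] ->
  {in tab &, injective fst}.
Proof.
elim: tab => //= y t IH /andP[yt ut] a b; rewrite !inE.
case/orP=> [/eqP->|at_] /orP[/eqP->|bt] E //; last exact: IH.
  by case/negP: yt; rewrite E; apply: map_f.
by case/negP: yt; rewrite -E; apply: map_f.
Qed.

(** * The invariant of the sets A_v *)

Section TableInvariant.
Variables (R : realType) (T : eqType) (G : nat).
Implicit Types (st : state T) (x r v w : T) (vA : T * seq T) (tab : seq (T * seq T)).

Notation members tab := (flatten [seq vA.2 | vA <- tab]).

(** In [table_balanced] the predicate only has to contain the keys of the alive sets: requests let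
    sets die without a change of [b], which is cut down to the alive ones at the next move. *)
Record table_inv st tab : Prop := TableInv {
  table_keys : uniq [seq vA.1 | vA <- tab];
  table_disjoint : uniq (members tab);
  table_holes : forall x, hole st x -> x \in members tab;
  table_evd : forall x, x \in members tab -> (x \in prv st) && (x \in evd st);
  table_tree : forall vA, vA \in tab -> treelike (tree0 st) vA.2;
  table_inC : size tab <= count (inC st) (undup (prv st));
  table_stale : forall x, stale st x -> ~~ inC st x;
  table_balanced : exists b : pred T,
    (forall vA, vA \in tab -> alive st vA -> b vA.1) /\ balanced R G b tab }.

Lemma alive_sub st st' vA : prv st' = prv st -> tree0 st' = tree0 st ->
  {in vA.2, forall x, hole st' x -> hole st x} -> (forall x, stale st' x -> stale st x) ->
  alive st' vA -> alive st vA.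
Proof.
move=> ep et hh ss /andP[/allP h1 /hasP[w wU /andP[sw aw]]]; apply/andP; split.
  by apply/allP => x xA; apply: hh => //; apply: h1.
rewrite ep in wU; apply/hasP; exists w => //; rewrite ss //=.
by apply: sub_has aw => a; rewrite et.
Qed.

Lemma table_inv_mark st r tab : table_inv st tab -> table_inv (mark st r) tab.
Proof.
case=> h1 h2 h3 h4 h5 h6 h7 [b [hb1 hb2]]; split; rewrite ?markE //.
- by move=> x; rewrite hole_mark => /andP[/h3].
- by rewrite (eq_count (a2 := inC st)) // => x; rewrite markE.
- by move=> x; rewrite stale_mark markE => /andP[/h7].
exists b; split=> // vA vAt al; apply: hb1 => //; apply: alive_sub al; rewrite ?markE //.
  by move=> x _; rewrite hole_mark => /andP[].
by move=> x; rewrite stale_mark => /andP[].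
Qed.

(** Subphase I evicts only pages of C and ends when no stale page of C is left, so the table starts
    with at most |C| singletons. *)
Lemma table_inv_init st : (forall x, x \in evd st -> inC st x) ->
  (forall x, stale st x -> ~~ inC st x) ->
  table_inv st (init_table st) /\ table_size (init_table st) = size (init_table st).
Proof.
move=> evC sC.
have keys : [seq vA.1 | vA <- init_table st] = [seq v <- undup (prv st) | hole st v].
  by rewrite /init_table -map_comp; apply: map_id.
have mem : members (init_table st) = [seq v <- undup (prv st) | hole st v].
  rewrite /init_table -map_comp /gverts; elim: [seq v <- undup (prv st) | hole st v] => //= x l IH.
  by rewrite IH.
split; last by rewrite /table_size mem /init_table size_map.
split; rewrite ?keys ?mem ?filter_uniq ?undup_uniq //.
- by move=> x hx; rewrite mem_filter hx mem_undup; case/and3P: hx.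
- by move=> x; rewrite mem_filter => /andP[/and3P[-> ->]].
- by move=> vA /mapP[v _ ->].
- rewrite /init_table size_map size_filter; apply: sub_count => x /and3P[_ xe _]; exact: evC.
exists predT; split=> //; rewrite /balanced /nkeys count_predT; split.
- move=> vA /mapP[v _ ->] _ /=; rewrite lerDr; exact: divr_ge0.
- by rewrite !subrr mulr0 addr0 big_pred0.
Qed.

Lemma table_inv_grow st r tab vw : table_inv st tab -> legal_move st tab vw ->
  count (hole st) (undup (prv st)) <= G ->
  let tab' := grow vw tab in
  [/\ table_inv (replace st r (vw.2, SubII tab')) tab', size tab' = size tab
    & table_size tab' = (table_size tab).+1].
Proof.
case: vw => v w [h1 h2 h3 h4 h5 h6 h7 [b [hb1 hb2]]] /= [[A [vA al min adjw]] sw] hG.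
rewrite /Defs.adjacent /= in adjw; rewrite /= in vA sw min.
set tab' := grow (v, w) tab; set st' := replace _ _ _.
have vkey : v \in [seq vA.1 | vA <- tab] by apply/mapP; exists (v, A).
have pF := grow_flatten w h1 vkey.
have wm : w \notin members tab.
  by apply/negP => /h4/andP[_ we]; case/and3P: sw => _ _; rewrite we.
have hole' x : hole st' x = hole st x || (x == w) by rewrite hole_replace.
have stale' x : stale st' x = stale st x && (x != w) by rewrite stale_replace.
have uniq_key B B' : (v, B) \in tab -> (v, B') \in tab -> B = B'.
  by move=> m1 m2; case: (uniq_keys_inj h1 m1 m2 erefl).
split.
- split.
  + by rewrite grow_keys.
  + by rewrite (perm_uniq pF) /= wm h2.
  + by move=> x; rewrite hole' (perm_mem pF) inE => /orP[/h3 ->|->]; rewrite ?orbT.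
  + move=> x; rewrite (perm_mem pF) !replaceE !inE /= => /orP[/eqP->|/h4/andP[-> ->]]; last by rewrite orbT.
    by rewrite eqxx; case/and3P: sw => ->.
  + move=> u /mem_grow /(_ h1) [[_ /h5]|[B vB ->]]; rewrite replaceE //=.
    by rewrite (h5 _ vB) andbT (uniq_key _ _ vB vA) adjw orbT.
  + rewrite replaceE size_map (eq_count (a2 := inC st)) // => x; exact: inC_replace.
  + by move=> x; rewrite stale' inC_replace => /andP[/h7].
  pose b' := [pred u | has (fun uB => (uB.1 == u) && alive st uB) tab].
  have b'v : b' v by apply/hasP; exists (v, A); rewrite ?eqxx.
  have b'P u : u \in tab -> b' u.1 -> alive st u.
    by move=> ut /hasP[u' u't /andP[/eqP E au']]; rewrite -(uniq_keys_inj h1 u't ut E).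
  exists b'; split.
    move=> u /mem_grow /(_ h1) [[uv ut] au|[B _ -> _]]; last exact: b'v.
    apply/hasP; exists u => //; rewrite eqxx /=; apply: alive_sub au; rewrite ?replaceE //.
      move=> x xu; rewrite hole' => /orP[//|/eqP xw]; case/negP: wm; rewrite -xw.
      by apply/flattenP; exists u.2 => //; apply: map_f.
    by move=> x; rewrite stale' => /andP[].
  have [bal1 bal2] : balanced R G b' tab.
    apply: balanced_shrink hb2 => u /hasP[[u' B] ut /andP[/eqP <- al']]; exact: hb1 al'.
  have nk : nkeys b' tab' = nkeys b' tab.
    by rewrite /nkeys -!(count_map fst b') grow_keys.
  (* The alive sets are disjoint, consist of holes and are at least as large as [A], and there are
     at most G holes. *)
  have smallest : nkeys b' tab * size A <= G.
    apply: leq_trans hG; apply: leq_trans (_ : count (hole st) (members tab) <= _).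
      rewrite count_flatten -map_comp sumnE big_map /nkeys count_sum big_distrl /= !(big_seq_cond xpredT).
      apply: leq_sum => u; rewrite andbT => ut; rewrite -[has _ _]/(b' u.1).
      case: (boolP (b' u.1)) => // bu; rewrite mul1n; have au := b'P u ut bu; apply: leq_trans (min u ut au) _.
      by case/andP: au; rewrite all_count => /eqP ->.
    rewrite -size_filter; apply: uniq_sub_count; first exact: filter_uniq.
    - by move=> x; rewrite mem_filter mem_undup => /andP[/and3P[->]].
    - exact: filter_all.
  rewrite /balanced nk size_map; split.
    move=> u /mem_grow /(_ h1) [[_ ut]|[B vB ->] _]; first exact: bal1.
    rewrite /= (uniq_key _ _ vB vA) -natr1 lerD2r ler_pdivlMr; first by rewrite -natrM ler_nat mulnC.
    by rewrite ltr0n -has_count; apply/hasP; exists (v, A).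
  rewrite big_map /=; apply: le_trans bal2; rewrite le_eqVlt; apply/orP; left; apply/eqP.
  apply: eq_big => u /=; first by case: ifP.
  by case: eqP => //= ->; have := b'v => /= ->.
- by rewrite /tab' /grow size_map.
- by rewrite /table_size (perm_size pF).
Qed.

End TableInvariant.

(** * The number of stale pages when Subphase III begins *)

Section PhaseAnalysis.
Variables (R : realType) (T : eqType) (k : nat) (e : rel T) (r : R).
Variables (P p : seq T) (g0 : rel T).
Local Open Scope ring_scope.
Hypothesis e_sym : symmetric e.
Hypothesis r_ge0 : 0 <= r.
Hypothesis Hr : halving_bounded k e r.
Hypothesis P_path : in_paths e P.
Hypothesis p_path : in_paths e p.
Hypothesis g0_tree : spanning_tree P g0.
Implicit Types (st : state T) (x q w : T) (s t : seq T) (o : T * subphase T).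

Notation U := (undup P).
Notation G := (new_pages P p).
Notation core := (core k P p g0).
Notation faulted := (faulted k P p g0).

Lemma reach_treelike K a A : {subset A <= K} -> (forall u v, g0 u v -> adj e u v) ->
  treelike g0 A -> (exists2 x, x \in A & reach e K a x) -> forall x, x \in A -> reach e K a x.
Proof.
move=> + g0adj; elim: A => [|w A IH] AK /=; first by move=> _ [].
have wK : w \in K by apply: AK; rewrite mem_head.
have {}IH := IH (fun x (xA : x \in A) => AK x (mem_behead (s := w :: A) xA)).
case/andP=> /orP[/nilP A0|/hasP[z zA zw]] tA [x xA rx] y.
  by move: xA rx; rewrite A0 !inE => /eqP-> ? /eqP->.
have rA : exists2 x, x \in A & reach e K a x.
  move: xA rx; rewrite inE => /orP[/eqP-> rw|xA rx]; last by exists x.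
  exists z => //; apply: reach_step rw; first by apply: AK; rewrite inE zA orbT.
  by rewrite adj_sym // g0adj.
rewrite inE => /orP[/eqP->|yA]; last exact: IH.
by apply: reach_step wK (g0adj _ _ zw) (IH tA rA z zA).
Qed.

(** Applies [harm_stale] to the stale pages [S], with [K] the marked pages and the holes in sets
    that contain a marked page. A hole next to a stale page lies in such a set: its set is dead
    although it has a stale neighbour, so one of its members is no longer a hole and must be
    marked. *)
Lemma stale_harm st q s tab : faulted st q s -> table_inv R G st tab -> ~~ has (alive st) tab ->
  harm R (count (stale st) U) <= harm R G + 2 * r + 1.
Proof.
move=> F [t1 t2 t3 t4 t5 _ t7 _] /hasPn dead.
have sizes := faulted_sizes F; case: F => ePrv eTree eCur qcur _ _ _ _ fr.
have g0adj u v : g0 u v -> adj e u v.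
  by case: g0_tree => _ ge _ _ /ge; apply: gedge_adj.
pose hit (vA : T * seq T) := has (mem (cur st)) vA.2.
pose touched := flatten [seq vA.2 | vA <- tab & hit vA].
pose Hs := [seq x <- U | hole st x && (x \in touched)].
pose K := undup (cur st) ++ Hs; pose S := [seq x <- U | stale st x].
have tmem vA x : vA \in tab -> x \in vA.2 -> x \in flatten [seq vA.2 | vA <- tab].
  by move=> vt xv; apply/flattenP; exists vA.2 => //; apply: map_f.
have touchedK vA : vA \in tab -> hit vA -> {subset vA.2 <= K}.
  move=> vt hv x xv; have /andP[xP xe] := t4 x (tmem vA x vt xv).
  rewrite mem_cat mem_undup mem_filter mem_undup.
  case: (boolP (x \in cur st)) => //= xc; rewrite /hole xP xe xc -ePrv xP andbT /=.
  by apply/flattenP; exists vA.2 => //; apply: map_f; rewrite mem_filter hv.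
(* The marked and the stale pages number k + 1, and there are at most G - 1 holes, so the excess
   over k is between 1 and G. *)
have KSsize : size (K ++ S) = (k + (size Hs).+1)%N.
  have sS : size S = count (stale st) U by rewrite size_filter.
  by move: sizes; rewrite !size_cat sS; move: (count _ _) (size _) (size _) => *; lia.
have [a [l curE]] : exists a l, cur st = a :: l.
  by case: (cur st) qcur => // a l _; exists a, l.
have cK : connected e K a.
  have al : path (adj e) a l.
    have : in_paths e (cur st ++ s) by rewrite eCur.
    by rewrite curE /in_paths /= cat_path => /andP[].
  have curK : {subset a :: l <= K} by move=> x xc; rewrite mem_cat mem_undup curE xc.
  have reach_cur x : x \in cur st -> reach e K a x.
    by rewrite curE => xc; apply: (reach_sub curK); apply: reach_walk.
  split; first by apply: curK; rewrite mem_head.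
  move=> x; rewrite mem_cat mem_undup => /orP[/reach_cur//|].
  rewrite mem_filter => /andP[/andP[_ /flattenP[A /mapP[vA]]]].
  rewrite mem_filter => /andP[hv vt] -> xA _.
  apply: (reach_treelike (touchedK vA vt hv) g0adj _ _ xA).
    by rewrite -eTree t5.
  by have /hasP[y yA yc] := hv; exists y => //; apply: reach_cur.
have -> : count (stale st) U = size S by rewrite size_filter.
apply: (harm_stale e_sym r_ge0 Hr P_path g0_tree cK).
- rewrite !cat_uniq undup_uniq !filter_uniq ?undup_uniq //= andbT; apply/andP; split.
    by apply/hasPn => x; rewrite mem_filter !mem_undup => /andP[/andP[/and3P[_ _ xc] _] _].
  rewrite andbT; apply/hasPn => x; rewrite mem_filter => /andP[sx _].
  rewrite mem_cat negb_or mem_undup; case/and3P: (sx) => _ -> _ /=.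
  by rewrite mem_filter (negbTE (stale_notin_hole sx)).
- by move=> x; rewrite mem_filter mem_undup => /andP[].
- have hs : (size Hs <= count (hole st) U)%N.
    by rewrite size_filter; apply: sub_count => x /andP[].
  by rewrite KSsize; lia.
- move=> x; rewrite mem_filter mem_undup => /andP[sx xP].
  have := t7 x sx; rewrite /inC /deg /gverts mem_undup ePrv eTree xP /= negbK.
  exact: eqP.
- move=> u v; rewrite mem_filter => /andP[sv _] uv.
  have /andP[uP vP] := tree_mem g0_tree uv.
  rewrite !mem_cat mem_undup [u \in S]mem_filter mem_undup uP andbT.
  case: (boolP (u \in cur st)) => //= uc.
  case: (boolP (stale st u)) => [_|us]; first by rewrite orbT.
  have hu : hole st u by move: us; rewrite /stale /hole ePrv uP uc /= negbK => ->.
  have /flattenP[A /mapP[vA vt ->] uA] := t3 u hu.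
  rewrite orbF mem_filter hu mem_undup uP andbT /=.
  have := dead vA vt; rewrite /alive negb_and => /orP[|/hasPn nos].
    rewrite -has_predC => /hasP[x xA nhx].
    have /andP[xP xe] := t4 x (tmem vA x vt xA).
    have xc : x \in cur st by move: nhx; rewrite /= /hole xP xe /= negbK.
    apply/flattenP; exists vA.2 => //; apply: map_f; rewrite mem_filter vt andbT.
    by apply/hasP; exists x.
  have := nos v; rewrite /gverts mem_undup ePrv vP sv /= => /(_ isT) /hasPn /(_ u uA).
  by rewrite eTree uv.
Qed.

End PhaseAnalysis.

(** * The expected cost of a phase *)

Section PhaseCost.
Variables (R : realType) (T : eqType) (k : nat) (ch : choices T).
Variables (P p : seq T) (g0 : rel T) (Y : R).
Local Open Scope ring_scope.
Implicit Types (st : state T) (x q w : T) (s t : seq T) (o : T * subphase T).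

Notation U := (undup P).
Notation G := (new_pages P p).
Notation core := (core k P p g0).
Notation faulted := (faulted k P p g0).

Hypothesis ch_legal : legal_choices ch.
Hypothesis pk : (size (undup p) <= k)%N.
Hypothesis Y_ge0 : 0 <= Y.
Hypothesis harm_C : harm R (branching P g0) <= Y.
Hypothesis harm_III : forall st q s tab, faulted st q s -> table_inv R G st tab ->
  ~~ has (alive st) tab -> harm R (count (stale st) U) <= harm R G + Y.

(** For m > 0, the mean of [pot R b j] over j < m: the potential that a random eviction among m
    pages creates. *)
Definition gain b m : R := if (b <= m)%N then harm R m - harm R b else 0.

(** Of this, 2 G is for the [minn] term of [phi], and 1 + Y is for each hole, each new page to come
    and the fault that opens Subphase III, G items in all. *)
Definition cost_III : R := G%:R * (3 + Y).

(* Bounds the expected number of further faults in the phase.  In Subphase III a fault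
   with fewer than G stale pages is paid by the [minn] term: at most 2 * G pages are
   then unmarked, and each of them faults at most once. *)
Definition phi st s : R :=
  match sub st with
  | SubI => pots R P 0 (fun x => stale st x && inC st x) (hole st) s
      + (fresh P (cur st) s)%:R * (1 + Y) + G%:R * Y + cost_III
  | SubII tab => G%:R * harm R (size tab) + (size tab)%:R - (table_size tab)%:R + cost_III
  | SubIII => pots R P G (stale st) (hole st) s
      + (minn (count (stale st) U + count (hole st) U) (2 * G))%:R
      + (fresh P (cur st) s)%:R * (1 + Y)
  end.

Definition inv st : Prop :=
  match sub st with
  | SubI => forall x, x \in evd st -> inC st x
  | SubII tab => table_inv R G st tab
  | SubIII => harm R (count (stale st) U) <= harm R G + Y
  end.

Lemma potE b m : (b <= m)%N -> pot R b m = 1 + gain b m.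
Proof. by rewrite /pot /gain => ->. Qed.

Lemma gain_le m : harm R m <= harm R G + Y -> gain G m <= Y.
Proof. by rewrite /gain; case: ifP => _ ?; [lra | exact: Y_ge0]. Qed.

Lemma mean_pots b (A H : pred T) s : (forall w, A w -> ~~ H w) -> (0 < count A U)%N ->
  (\sum_(w <- [seq w <- U | A w])
     pots R P b [pred x | A x && (x != w)] [pred x | H x || (x == w)] s) / (count A U)%:R
  <= pots R P b A H s + gain b (count A U).
Proof.
move=> AH m0; rewrite ler_pdivrMr ?ltr0n //; apply: le_trans (pots_evict R P b s AH) _.
rewrite mulrDl mulrC lerD2l /gain; case: leqP => [/sum_pot ->|/ltnW/sum_pot_small ->].
  by rewrite mulrC.
by rewrite mul0r.
Qed.

Lemma evict_III_cost st q s : faulted st q s -> harm R (count (stale st) U) <= harm R G + Y ->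
  law (evict_III R st) (fun o => stale st o.1 /\ inv (replace st q o)) /\
  dexp (evict_III R st) (fun o => phi (replace st q o) s) <=
    pots R P G (stale st) (hole st) s + gain G (count (stale st) U)
    + (minn (count (stale st) U + count (hole st) U) (2 * G))%:R
    + (fresh P (cur st) s)%:R * (1 + Y).
Proof.
move=> F hm; have m0 := faulted_stale_gt0 pk F; have pL := faulted_unmarked F.
set m := count _ _ in m0 hm *.
have sm : size [seq x <- cache st | ~~ marked st x] = m by rewrite (perm_size pL) size_filter.
have mem_stale x : x \in [seq x <- cache st | ~~ marked st x] -> stale st x && (x \in P).
  by rewrite (perm_mem pL) mem_filter mem_undup.
have count_stale w : w \in P -> stale st w ->
    (count (stale (replace st q (w, SubIII T))) U).+1 = m.
  move=> wP sw; rewrite /m -(count_neq (stale st) w (undup_uniq P)) mem_undup sw wP addn1.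
  by congr _.+1; apply: eq_count => x; rewrite stale_replace.
have count_hole w : w \in P -> stale st w ->
    count (hole (replace st q (w, SubIII T))) U = (count (hole st) U).+1.
  move=> wP sw; have h := count_neq (hole (replace st q (w, SubIII T))) w (undup_uniq P).
  rewrite -h mem_undup wP hole_replace // eqxx orbT addn1; congr _.+1; apply: eq_count => x /=.
  rewrite hole_replace //=; have [->|_] := eqVneq x w; last by rewrite orbF andbT.
  by rewrite andbF (negbTE (stale_notin_hole sw)).
split.
  apply: law_uniform => [|x /mem_stale/andP[sx xP]]; first by rewrite -size_eq0 sm -lt0n.
  split=> //; rewrite /inv sub_replace /=; apply: le_trans hm; apply: harm_le.
  by rewrite -(count_stale x).
rewrite dexp_uniform sm (perm_big _ pL) /=.
rewrite (eq_big_seq (fun w => pots R P G [pred x | stale st x && (x != w)]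
      [pred x | hole st x || (x == w)] s + ((minn (m + count (hole st) U) (2 * G))%:R
    + (fresh P (cur st) s)%:R * (1 + Y)))); last first.
  move=> w; rewrite mem_filter mem_undup => /andP[sw wP].
  rewrite /phi sub_replace /= cur_replace -addrA; congr (_ + (_%:R + _)).
    by apply: eq_pots => x _ /=; rewrite ?stale_replace ?hole_replace.
  (* The evicted page passes from the stale pages to the holes, so the sum in the [minn] term is
     unchanged. *)
  by rewrite count_hole // addnS -addSn count_stale.
rewrite big_split mulrDl /= -addrA; apply: lerD; first by apply: mean_pots => // w; exact: stale_notin_hole.
rewrite big_const_seq count_predT iter_addr_0 size_filter -/m -[_ *+ _]mulr_natr mulfK //.
by rewrite pnatr_eq0 -lt0n.
Qed.

(** A move enlarges the table by one page, so [phi] falls by 1 and pays for the fault. If no set is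
    alive, [balanced_total] shows that at least [cost_III] is left, enough for Subphase III. *)
Lemma evict_II_cost st q s tab : faulted st q s -> table_inv R G st tab ->
  law (evict_II R ch st tab) (fun o => stale st o.1 /\ inv (replace st q o)) /\
  dexp (evict_II R ch st tab) (fun o => phi (replace st q o) s) + 1 <=
    G%:R * harm R (size tab) + (size tab)%:R - (table_size tab)%:R + cost_III.
Proof.
move=> F tinv; have [h1 h2 h3 h4 h5 h6 h7 h8 h9] := F.
have tab_total : (table_size tab)%:R <= G%:R * harm R (size tab) + (size tab)%:R :> R.
  by case: tinv => _ _ _ _ _ _ _ [b [_ /balanced_total]].
rewrite /evict_II; case: ifP => [al|/negbT dead].
  have mv := ch_legal.2 st tab al; have hG : (count (hole st) (undup (prv st)) <= G)%N.
    by rewrite h1; lia.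
  have [tinv' st' tt'] := table_inv_grow q tinv mv hG.
  split; first by apply: law_dret; split; [exact: mv.2 | rewrite /inv sub_replace].
  by rewrite dexp_dret /phi sub_replace /= st' tt' -natr1; lra.
have hm := harm_III F tinv dead.
have [L E] := evict_III_cost F hm; split=> //.
have g1 := gain_le hm; set m := count _ _ in hm E g1.
have pm : pot R G m <= 1 + Y.
  by rewrite /pot; move: g1; rewrite /gain; case: ifP => _; have := Y_ge0; lra.
have := pots_le R P G (stale st) (hole st) s; rewrite -/m => pl.
have pl' : pots R P G (stale st) (hole st) s <= (count (hole st) U)%:R * (1 + Y).
  by apply: le_trans pl _; rewrite ler_wpM2l.
have fr : G%:R = (count (hole st) U)%:R + (fresh P (cur st) s)%:R + 1 :> R.
  by rewrite -h9 -natr1 natrD.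
have mn : (minn (m + count (hole st) U) (2 * G))%:R <= 2 * G%:R :> R.
  by rewrite -natrM ler_nat geq_minr.
have G1 : 1 <= G%:R :> R by rewrite ler1n -h9.
rewrite /cost_III.
have : G%:R * (3 + Y) = 3 * G%:R + ((count (hole st) U)%:R + (fresh P (cur st) s)%:R + 1) * Y.
  by rewrite -fr; ring.
lra.
Qed.

(** The term [1 + harm R (count A U)] is released by the request, and pays for the fault and the
    mean potential of the new hole. When C is exhausted, the reserve G Y covers Subphase II, whose
    table of at most |C| singletons has as many elements as sets. *)
Lemma evict_I_cost st q s : faulted st q s -> (forall x, x \in evd st -> inC st x) ->
  let A := fun x => stale st x && inC st x in
  law (evict_I R ch st) (fun o => stale st o.1 /\ inv (replace st q o)) /\
  dexp (evict_I R ch st) (fun o => phi (replace st q o) s) + 1 <=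
    pots R P 0 A (hole st) s + (1 + harm R (count A U))
      + (fresh P (cur st) s)%:R * (1 + Y) + G%:R * Y + cost_III.
Proof.
move=> F evC A; have [h1 h2 h3 h4 h5 h6 h7 h8 h9] := F.
rewrite /evict_I /gverts h1; case: nilP => [noC|/eqP someC].
  have [|tinv ts] := @table_inv_init R T G st evC.
    move=> x sx; apply/negP => Cx; have : x \in [seq x <- U | stale st x && inC st x].
      by rewrite mem_filter sx Cx mem_undup -h1; case/and3P: sx.
    by rewrite noC.
  have [L E] := evict_II_cost F tinv; split=> //; apply: le_trans E _.
  have c0 : harm R (size (init_table st)) <= Y.
    apply: le_trans harm_C; apply: harm_le; apply: leq_trans (table_inC tinv) _.
    rewrite h1 /branching; apply: sub_count => x /andP[_]; by rewrite /deg /gverts h1 h2.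
  have p0 : 0 <= pots R P 0 A (hole st) s by apply: sumr_ge0 => w _; exact: pot_ge0.
  have hh := harm_ge0 R (count A U).
  have f0 : 0 <= (fresh P (cur st) s)%:R * (1 + Y) by rewrite mulr_ge0 // addr_ge0.
  have : G%:R * harm R (size (init_table st)) <= G%:R * Y by rewrite ler_wpM2l.
  by rewrite ts; lra.
set L := [seq x <- U | stale st x && inC st x] in someC *.
have m0 : (0 < count A U)%N by rewrite -size_filter lt0n size_eq0.
have memL x : x \in L -> [/\ stale st x, inC st x & x \in P].
  by rewrite mem_filter mem_undup => /andP[/andP[-> ->] ->].
split.
  apply: law_uniform => // x /memL[sx Cx xP]; split=> //.
  by rewrite /inv sub_replace /= evd_replace => y; rewrite inE inC_replace => /orP[/eqP->|/evC].
have sL : size L = count A U by rewrite size_filter.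
rewrite dexp_uniform sL.
rewrite (eq_big_seq (fun w => pots R P 0 [pred x | A x && (x != w)]
      [pred x | hole st x || (x == w)] s + ((fresh P (cur st) s)%:R * (1 + Y)
    + G%:R * Y + cost_III))); last first.
  move=> w /memL[sw Cw wP].
  rewrite /phi sub_replace /= cur_replace -!addrA; congr (_ + _).
  apply: eq_pots => x _ /=; rewrite ?stale_replace ?inC_replace ?hole_replace //.
  by rewrite /A andbAC.
rewrite big_split mulrDl /=.
have AH w : A w -> ~~ hole st w by move=> /andP[/stale_notin_hole].
have := @mean_pots 0 A (hole st) s AH m0; rewrite /gain leq0n harm0 subr0 => mp.
set c := (_ * (1 + Y) + _ + _).
rewrite big_const_seq count_predT iter_addr_0 sL -[c *+ _]mulr_natr mulfK ?pnatr_eq0 -?lt0n //.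
by rewrite /c; lra.
Qed.

Lemma pots_mark b (A A' : pred T) st q s : prv st = P -> (hole st q -> ~~ A q) ->
  (forall x, A' x = A x && (x != q)) ->
  pots R P b A (hole st) (q :: s) = pots R P b A' (hole (mark st q)) s
    + (if hole st q then pot R b (count A' U) else 0).
Proof.
move=> eP nA eA; rewrite pots_cons => [|hq]; last by rewrite -eP nA //; case/and3P: hq.
have eA' : A' =1 [pred w | A w && (w != q)] by [].
rewrite (eq_count eA'); congr (_ + _).
by apply: eq_pots => x _ /=; rewrite ?eA ?hole_mark.
Qed.

Lemma hit_cost st q s : core st (q :: s) -> q \in cache st -> inv st ->
  inv (mark st q) /\ phi (mark st q) s <= phi st (q :: s).
Proof.
move=> C qc; have eP := core_prv C.
have stale_le : (count (stale (mark st q)) U <= count (stale st) U)%N.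
  by apply: sub_count => x; rewrite stale_mark => /andP[].
have hole_le : (count (hole (mark st q)) U <= count (hole st) U)%N.
  by apply: sub_count => x; rewrite hole_mark => /andP[].
have fr : (fresh P (cur (mark st q)) s)%:R * (1 + Y) <= (fresh P (cur st) (q :: s))%:R * (1 + Y) :> R.
  by rewrite ler_wpM2r ?addr_ge0 // ler_nat fresh_cons cur_mark leq_addl.
rewrite /inv /phi sub_mark; case: (sub st) => [|tab|] I.
- split; first by move=> x; rewrite !markE; exact: I.
  rewrite !lerD2r lerD // (@pots_mark _ _ (fun x => stale (mark st q) x && inC (mark st q) x)) //.
  + by rewrite lerDl; case: ifP => // _; apply: pot_ge0.
  + by move=> hq; apply/negP => /andP[/stale_notin_hole]; rewrite hq.
  + by move=> x; rewrite stale_mark inC_mark andbAC.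
- by split=> //; apply: table_inv_mark.
- split; first by apply: le_trans I; apply: harm_le.
  rewrite lerD // lerD //; last by rewrite ler_nat leq_min geq_minr andbT (leq_trans (geq_minl _ _)) // leq_add.
  rewrite (@pots_mark _ _ (stale (mark st q))) //.
  + by rewrite lerDl; case: ifP => // _; apply: pot_ge0.
  + by move=> hq; apply/negP => /stale_notin_hole; rewrite hq.
  + by move=> x; rewrite stale_mark.
Qed.

(** A requested hole releases its [pot], a requested new page 1 + Y. In Subphases I and III this
    pays for the fault and the mean increase by the eviction, except for late faults of Subphase
    III, which the [minn] term pays. *)
Lemma miss_cost st q s : core st (q :: s) -> q \notin cache st -> inv st ->
  law (evict R ch (mark st q)) (fun o => stale (mark st q) o.1 /\ inv (replace (mark st q) q o)) /\
  dexp (evict R ch (mark st q)) (fun o => phi (replace (mark st q) q o) s) + 1 <= phi st (q :: s).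
Proof.
move=> C qc; have eP := core_prv C; have [F [hq qcur]] := core_miss C qc.
have fr : (fresh P (cur st) (q :: s))%:R
    = (q \notin P)%:R + (fresh P (cur (mark st q)) s)%:R :> R.
  by rewrite fresh_cons cur_mark qcur andbT natrD.
have hG : ((count (hole (mark st q)) U).+1 <= G)%N.
  by have := faulted_fresh F; lia.
rewrite /inv /phi /evict sub_mark; case: (sub st) => [|tab|] I.
- have I' x : x \in evd (mark st q) -> inC (mark st q) x by rewrite !markE; exact: I.
  have [L E] := evict_I_cost F I'; split=> //; apply: le_trans E _.
  rewrite (@pots_mark _ _ (fun x => stale (mark st q) x && inC (mark st q) x)) //; first last.
  + by move=> x; rewrite stale_mark inC_mark andbAC.
  + by move=> h; apply/negP => /andP[/stale_notin_hole]; rewrite h.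
  set m := count _ _; rewrite hq fr !lerD2r.
  case: (q \in P) => /=; first by rewrite /pot leq0n harm0; lra.
  have : harm R m <= Y.
    apply: le_trans harm_C; apply: harm_le; apply: sub_count => x /andP[_ /andP[_]].
    by rewrite /deg /gverts !markE eP (core_tree C).
  lra.
- exact: evict_II_cost (table_inv_mark q I).
have hm : harm R (count (stale (mark st q)) U) <= harm R G + Y.
  by apply: le_trans I; apply: harm_le; apply: sub_count => x; rewrite stale_mark => /andP[].
have [L E] := evict_III_cost F hm; split=> //.
rewrite (@pots_mark _ _ (stale (mark st q))) //; first last.
+ by move=> x; rewrite stale_mark.
+ by move=> h; apply/negP => /stale_notin_hole; rewrite h.
move: E; set m := count (stale (mark st q)) U => E.
have g1 := gain_le hm; rewrite -/m in g1.
have um : (m + count (hole (mark st q)) U + (q \in P) <= count (stale st) U + count (hole st) U)%N.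
  rewrite -addnA leq_add //; first by apply: sub_count => x; rewrite stale_mark => /andP[].
  rewrite -(count_neq (hole st) q (undup_uniq P)) mem_undup hq andbb leq_add2r.
  by apply: sub_count => x; rewrite hole_mark.
rewrite hq fr; move: um; case: (q \in P) => /= um.
  case: (leqP G m) => Gm.
    have mn : (minn (m + count (hole (mark st q)) U) (2 * G))%:R
        <= (minn (count (stale st) U + count (hole st) U) (2 * G))%:R :> R.
      by rewrite ler_nat; lia.
    by rewrite (potE Gm); lra.
  (* Fewer than G stale pages and fewer than G holes remain, so the new minimum is their sum, at
     least one below the old one; [pot] and [gain] both vanish here. *)
  have mn : (minn (m + count (hole (mark st q)) U) (2 * G))%:R + 1
      <= (minn (count (stale st) U + count (hole st) U) (2 * G))%:R :> R.
    by rewrite natr1 ler_nat; lia.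
  have g0' : gain G m = 0 by rewrite /gain leqNgt Gm.
  by have := pot_ge0 R G m; lra.
have mn : (minn (m + count (hole (mark st q)) U) (2 * G))%:R
    <= (minn (count (stale st) U + count (hole st) U) (2 * G))%:R :> R.
  by rewrite ler_nat; lia.
lra.
Qed.

(** Faults so far plus [phi] form a supermartingale along the phase. *)
Lemma step_cost st q s : core st (q :: s) -> inv st ->
  law (step R k ch st q) (fun st' => core st' s /\ inv st') /\
  dexp (step R k ch st q) (fun st' => (nfaults st')%:R + phi st' s)
    <= (nfaults st)%:R + phi st (q :: s).
Proof.
move=> C I; rewrite /step (start_phase_id ch pk C) cache_mark.
case: (boolP (q \in cache st)) => qc.
  have [I' E] := hit_cost C qc I; split.
    by apply: law_dret; split=> //; apply: core_hit.
  by rewrite dexp_dret nfaults_mark lerD2l.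
have [L E] := miss_cost C qc I; have [F _] := core_miss C qc.
rewrite (core_size C) ltnn; split.
  apply: law_dbind L _ => o [so Io]; apply: law_dret; split=> //.
  exact: core_evict F so.
rewrite dexp_dbind.
have -> : dexp (evict R ch (mark st q)) (fun o => dexp (dret R (replace (mark st q) q o))
     (fun st' => (nfaults st')%:R + phi st' s))
   = dexp (evict R ch (mark st q)) (fun=> (nfaults st).+1%:R)
     + dexp (evict R ch (mark st q)) (fun o => phi (replace (mark st q) q o) s).
  rewrite /dexp -big_split /=; apply: eq_bigr => o _.
  by rewrite -mulrDr; congr (_ * _); rewrite big_seq1 mul1r nfaults_replace nfaults_mark.
rewrite (dexp_cst _ L) -natr1; lra.
Qed.

Lemma run_cost st s : core st s -> inv st ->
  law (run R k ch st s) (fun st' => core st' [::] /\ inv st') /\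
  dexp (run R k ch st s) (fun st' => (nfaults st')%:R + phi st' [::]) <= (nfaults st)%:R + phi st s.
Proof.
elim: s st => [|q s IH] st C I /=; first by rewrite dexp_dret; split=> //; apply: law_dret.
have [L E] := step_cost C I; split; first by apply: law_dbind L _ => st' [C' I']; case: (IH st' C' I').
rewrite dexp_dbind; apply: le_trans E; apply: dexp_le L.2 _ => st' [C' I'].
by case: (IH st' C' I').
Qed.

Lemma phi_ge0 st s : inv st -> 0 <= phi st s.
Proof.
have c0 : 0 <= cost_III by rewrite mulr_ge0 // addr_ge0.
have f0 t : 0 <= (fresh P t s)%:R * (1 + Y) by rewrite mulr_ge0 // addr_ge0.
have p0 b A H : 0 <= pots R P b A H s by apply: sumr_ge0 => w _; exact: pot_ge0.
have gy : 0 <= G%:R * Y by rewrite mulr_ge0.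
rewrite /inv /phi; case: (sub st) => [_|tab|_].
- by rewrite !addr_ge0.
- by case=> _ _ _ _ _ _ _ [b [_ /balanced_total]]; have := c0; lra.
- by rewrite !addr_ge0.
Qed.

(** There are no holes at the start, so [phi] is G (1 + Y) + G Y + G (3 + Y). *)
Lemma phase_cost st : core st p -> sub st = SubI T -> evd st = [::] ->
  law (run R k ch st p) (fun st' => core st' [::]) /\
  dexp (run R k ch st p) (fun st' => (nfaults st')%:R)
    <= (nfaults st)%:R + G%:R * (4 + 3 * Y).
Proof.
move=> C sI e0; have I : inv st by rewrite /inv sI e0.
have [L E] := run_cost C I; split; first by apply: law_sub L => st' [].
apply: le_trans (_ : _ <= (nfaults st)%:R + phi st p) _.
  by apply: le_trans E; apply: dexp_le L.2 _ => st' [_ I']; rewrite lerDl phi_ge0.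
have noH x : hole st x = false by rewrite /hole e0 andbF.
have := core_fresh C; rewrite (eq_count noH) count_pred0 add0n => fG.
rewrite /phi sI lerD2l fG /pots big_pred0 // /cost_III.
lra.
Qed.

End PhaseCost.

(** * The competitive ratio *)

Section WholeRun.
Variables (R : realType) (T : eqType) (k : nat) (e : rel T) (ch : choices T) (r : R).
Local Open Scope ring_scope.
Hypothesis k_gt0 : (0 < k)%N.
Hypothesis e_sym : symmetric e.
Hypothesis ch_legal : legal_choices ch.
Hypothesis r_ge0 : 0 <= r.
Hypothesis Hr : halving_bounded k e r.
Implicit Types (st : state T) (s q p : seq T) (ps : seq (seq T)).

(** The bound of [harm_branching]; it also exceeds the 2 r + 1 of [stale_harm]. *)
Let Y : R := 2 * r + 4.

Lemma dexp_run_cat st s t f :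
  dexp (run R k ch st (s ++ t)) f = dexp (run R k ch st s) (fun st' => dexp (run R k ch st' t) f).
Proof.
elim: s st => [|x s IH] st /=; first by rewrite dexp_dret.
by rewrite !dexp_dbind /dexp; apply: eq_bigr => o _; rewrite -/(dexp _ _) IH.
Qed.

Lemma dexp_addr A (Q : A -> Prop) (d : dist R A) f c : law d Q ->
  dexp d (fun a => f a + c) = dexp d f + c.
Proof.
move=> L; rewrite -[in RHS](dexp_cst c L) /dexp -big_split; apply: eq_bigr => o _ /=.
by rewrite mulrDr.
Qed.

Definition boundary st q := [/\ cur st = q, uniq (cache st) & cache st =i q].

Lemma core_end st q p g0 : core k q p g0 st [::] -> size (undup p) = k -> boundary st p.
Proof.
case=> _ _ ep uc sc mc _ pk; rewrite cats0 in ep; split=> //.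
have sub : {subset undup p <= cache st} by move=> x; rewrite mem_undup mc ep => ->.
have [_ E] := uniq_min_size (undup_uniq p) sub (eq_leq (etrans sc (esym pk))).
by move=> x; rewrite -E mem_undup.
Qed.

Lemma next_phase_cost st q a p : boundary st q -> size (undup q) = k -> a \notin q ->
  (size (undup (a :: p)) <= k)%N -> in_paths e (q ++ a :: p) ->
  law (run R k ch st (a :: p)) (fun st' => size (undup (a :: p)) = k -> boundary st' (a :: p)) /\
  dexp (run R k ch st (a :: p)) (fun st' => (nfaults st')%:R)
    <= (nfaults st)%:R + (new_pages q (a :: p))%:R * (4 + 3 * Y).
Proof.
case: st => h c pr q' ed g sp n [qE uc mc] qk aq pk qp.
rewrite [cur _]/= in qE; rewrite [cache _]/= in uc mc; subst q'.
set st := State _ _ _ _ _ _ _ _.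
pose g0 := pick_tree ch h q.
pose st1 := State h c q [::] [::] g0 (SubI T) n.
(* The phase may be started in advance: in [st1] the current phase is empty and k > 0, so the
   request [a] does not open yet another one. *)
have sp1 : start_phase k ch st a = st1 by rewrite /start_phase /= aq qk leqnn.
have sp2 : start_phase k ch st1 a = st1 by rewrite /start_phase /= leqNgt k_gt0.
have -> : run R k ch st (a :: p) = run R k ch st1 (a :: p) by rewrite /= /step sp1 sp2.
have tr : spanning_tree q g0 by exact: ch_legal.1.
have [q_path [p_path qa]] : in_paths e q /\ in_paths e (a :: p) /\ adj e (last a q) a.
  case: (q) aq qp => [|b q1] _; first by rewrite /= adj_refl.
  by rewrite /in_paths /= cat_path /= => /andP[h1 /andP[h2 h3]].
have lq : last a q \in q.
  by case: (q) qk k_gt0 => [|b q1] /=; [move=> <- | rewrite mem_last].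
have C : core k q (a :: p) g0 st1 (a :: p).
  split=> //=.
  - by rewrite -qk; apply/perm_size/uniq_perm; rewrite ?undup_uniq // => x; rewrite mc mem_undup.
  - by move=> x; rewrite mc /stale /= !andbT.
  - rewrite (eq_count (a2 := pred0)) ?count_pred0 ?add0n; last by move=> x; rewrite /hole /= andbF.
    by rewrite /fresh /new_pages; congr (size (undup _)); apply: eq_filter => x; rewrite andbT.
have Y0 : 0 <= Y by rewrite /Y; have := r_ge0; lra.
(* The last request of [q] and the page [a] that opens the new phase are adjacent, and [a] is not in
   [q], as [harm_branching] requires. *)
have hC : harm R (branching q g0) <= Y by exact: (harm_branching e_sym r_ge0 Hr q_path tr qk lq aq qa).
have hIII st' x s tab : faulted k q (a :: p) g0 st' x s ->
    table_inv R (new_pages q (a :: p)) st' tab -> ~~ has (alive st') tab ->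
    harm R (count (stale st') (undup q)) <= harm R (new_pages q (a :: p)) + Y.
  move=> F ti dead; have := stale_harm e_sym r_ge0 Hr q_path p_path tr F ti dead.
  by rewrite /Y; lra.
have [L E] := phase_cost ch_legal pk Y0 hC hIII C erefl erefl.
by split=> //; apply: law_sub L => st' C' pk'; apply: core_end C' pk'.
Qed.

(** The last phase may be incomplete, so [boundary] is asked for only if a phase follows; [phased]
    then says that [q] has k distinct pages. *)
Lemma phases_cost ps q st : (ps != [::] -> boundary st q) -> phased k q ps ->
  in_paths e (q ++ flatten ps) ->
  dexp (run R k ch st (flatten ps)) (fun st' => (nfaults st')%:R)
    <= (nfaults st)%:R + (total_new q ps)%:R * (4 + 3 * Y).
Proof.
elim: ps q st => [|p ps IH] q st; first by move=> _ _ _; rewrite dexp_dret mul0r addr0.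
move=> /(_ isT) B /= /and4P[/eqP qk hd pk ph].
case: p hd pk ph => // a p aq pk ph qps.
have qp : in_paths e (q ++ a :: p).
  by move: qps; rewrite catA; exact: (fun h => (cat_sorted2 h).1).
have pps : in_paths e ((a :: p) ++ flatten ps) by exact: (cat_sorted2 qps).2.
have [L E] := next_phase_cost B qk aq pk qp.
rewrite dexp_run_cat natrD mulrDl addrA.
apply: le_trans (_ : _ <= dexp (run R k ch st (a :: p))
   (fun st' => (nfaults st')%:R + (total_new (a :: p) ps)%:R * (4 + 3 * Y))) _.
  apply: dexp_le L.2 _ => st' B'; apply: IH => // ps0; apply: B'.
  by case: (ps) ps0 ph => // p' ps' _ /andP[/eqP].
by rewrite (dexp_addr _ _ L) lerD2r.
Qed.

(** In the first phase nothing is evicted, so every fault adds a page to the cache. *)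
Definition first_phase st := [/\ uniq (cache st), cache st =i cur st & nfaults st = size (cache st)].

Lemma first_phase_run st s : first_phase st -> (size (undup (cur st ++ s)) <= k)%N ->
  law (run R k ch st s) (fun st' => first_phase st' /\ cur st' = cur st ++ s).
Proof.
elim: s st => [|x s IH] st [uc mc nc] sk /=; first by apply: law_dret; rewrite cats0.
have sp : start_phase k ch st x = st.
  case: st {IH uc mc nc} sk => h c pr q ed g sp n /= sk; rewrite /start_phase.
  case: ifP => // /andP[xq kq]; suff : (size (undup (x :: q)) <= k)%N.
    by rewrite /= (negbTE xq) /= ltnNge kq.
  apply: leq_trans (size_undup_sub _) sk => y.
  by rewrite mem_cat !inE => /orP[->|->]; rewrite ?orbT.
rewrite /step sp cache_mark.
have next st' : first_phase st' -> cur st' = rcons (cur st) x ->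
    law (run R k ch st' s) (fun st'' => first_phase st'' /\ cur st'' = cur st ++ x :: s).
  by move=> F' E'; rewrite -cat_rcons -E'; apply: IH; rewrite // E' cat_rcons.
case: (boolP (x \in cache st)) => xc.
  apply: law_dbind (law_dret _ erefl) _ => st' <-; apply: next; last exact: cur_mark.
  split; rewrite ?markE // => y; rewrite mem_rcons inE mc.
  by case: eqVneq => // ->; rewrite -mc xc.
have ck : (size (cache st) < k)%N.
  apply: leq_trans sk; rewrite -[X in (X <= _)%N]/(size (x :: cache st)).
  apply: uniq_leq_size; first by rewrite /= xc.
  by move=> y; rewrite mem_undup mem_cat !inE mc => /orP[->|->]; rewrite ?orbT.
rewrite ck; apply: law_dbind (law_dret _ erefl) _ => st' <-; apply: next.
  move: uc mc nc xc; case: (st) => h c pr q ed g sp' n /= uc mc nc xc; split=> /=.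
  - by rewrite xc.
  - by move=> y; rewrite inE mem_rcons inE mc.
  - by rewrite nc.
by case: (st).
Qed.

(** All pages of the first phase count as new. The factor is 2 (4 + 3 Y) with Y = 2 r + 4, where the
    2 comes from [total_new_le_opt]. *)
Lemma rto_faults_le s : in_paths e s ->
  rto_faults R k ch s <= (12 * r + 32) * (opt k s)%:R.
Proof.
move=> sp; have [p [ps [Es pk ph bound]]] := total_new_le_opt k_gt0 s.
rewrite Es in sp bound *; rewrite /rto_faults dexp_run_cat.
have L := @first_phase_run (init_state T) p (And3 isT (fun=> erefl) erefl) pk.
have X1 : 1 <= 4 + 3 * Y by rewrite /Y; have := r_ge0; lra.
apply: le_trans (_ : _ <= (size (undup p))%:R + (total_new p ps)%:R * (4 + 3 * Y)) _.
  apply: dexp_le_cst L _ => st' [[uc mc nc] cE].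
  have <- : nfaults st' = size (undup p).
    rewrite nc; apply/perm_size/uniq_perm; rewrite ?undup_uniq // => x.
    by rewrite mc cE mem_undup.
  apply: phases_cost => // _; split=> // x; first by rewrite mc cE.
have b2 : (size (undup p))%:R + (total_new p ps)%:R <= 2 * (opt k (p ++ flatten ps))%:R :> R.
  by rewrite -natrD -natrM ler_nat.
apply: le_trans (_ : (4 + 3 * Y) * ((size (undup p))%:R + (total_new p ps)%:R) <= _).
  by rewrite [leRHS]mulrDr [X in _ <= _ + X]mulrC lerD2r ler_peMl.
apply: le_trans (ler_wpM2l _ b2) _; first by apply: le_trans X1.
by rewrite mulrA /Y; apply: ler_wpM2r => //; lra.
Qed.

End WholeRun.

(** * Comparison of RTO with an arbitrary online algorithm *)

Lemma online_halving_bounded (R : realType) (T : eqType) (k : nat) (e : rel T) cost (r C : R) :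
  (0 < k)%N -> symmetric e -> @online_cost R T k cost -> (0 <= r)%R ->
  (forall s, in_paths e s -> (cost s <= r%:E * (opt k s)%:R%:E + C%:E)%E) ->
  halving_bounded k e r.
Proof.
move=> k0 es /online_cost_real[f [Ef f0 fr]] r0 H g a K S t g0 uKS sKS cK bef aft.
apply: (halving_lower_bound es uKS sKS cK bef aft f0 fr k0 (C := C)) => // s sp.
by rewrite -lee_fin -Ef EFinD EFinM; apply: H.
Qed.

Theorem mainTheorem1 (R : realType) :
  exists b1 b2 : R, (0 <= b1)%R /\ (0 <= b2)%R /\
    forall (k : nat) (T : choiceType) (e : rel T) (ch : choices T),
      (1 <= k)%N -> symmetric e -> legal_choices ch ->
      (r_RTO R k e ch <= b1%:E * r_obl R k e + b2%:E)%E.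
Proof.
exists (12%:R)%R, (32%:R)%R; split; first exact: ler0n; split; first exact: ler0n.
move=> k T e ch k0 es chl.
(* Any x above the infimum exceeds the ratio r of some algorithm, and the bound for r implies the
   one for x. *)
have key (x : R) : (r_obl R k e < x%:E)%E ->
    (0 < x)%R /\ (r_RTO R k e ch <= (12 * x + 32)%:E)%E.
  move=> /ereal_inf_lt[_ [cost oc <-]] /ereal_inf_lt[_ [r [r0 [C [C0 H]]] <-]].
  rewrite lte_fin => rx; split; first exact: le_lt_trans rx.
  have Hr := online_halving_bounded k0 es oc r0 H.
  apply: le_trans (_ : (12 * r + 32)%:E <= _)%E; last by rewrite lee_fin; lra.
  apply: ereal_inf_lbound; exists (12 * r + 32)%R => //; split; first by lra.
  by move=> s sp; rewrite -EFinM lee_fin; apply: rto_faults_le.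
case E : (r_obl R k e) => [x| |].
(* The infimum need not be attained; the slack [eps / 12] turns into [eps] under the factor 12. *)
- apply/lee_addgt0Pr => eps eps0.
  have [|_ h] := key (x + eps / 12)%R; first by rewrite E lte_fin ltrDl divr_gt0.
  apply: le_trans h _; rewrite -EFinM -!EFinD lee_fin.
  by rewrite mulrDr mulrCA mulfV ?pnatr_eq0 // mulr1; lra.
- by rewrite gt0_muley ?lte_fin ?ltr0n // addye // leey.
(* Ratios are nonnegative, so the infimum is not -oo. *)
- have [|] := key (-1)%R; first by rewrite E ltNyr.
  by rewrite ltr0N1.
Qed.
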